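(* Let $k,h$ be integers with $k\ge 3$ and $2\le h\le k-1$, and set $\delta=k+h$. There exists an integer $n_{\mathrm{int}}(k,\delta)\ge 2\delta+2$ such that for every $n\ge n_{\mathrm{int}}(k,\delta)$ the following holds. The matching-core candidate, i.e. the graph in $\mathcal{L}_{\mathcal{H}}^{2}(n,k,\delta)$ whose missing-edge graph is isomorphic to $hK_2\cup 2K_1$ and for which all vertices of $X$ incident with a missing edge have a common neighbor in $Y$, does not maximize the adjacency spectral radius over $\mathcal{L}_{\mathcal{H}}^{2}(n,k,\delta)$. Instead, the unique maximizer (up to isomorphism) is $G^\star_{h,k,n}$, whose missing-edge graph is $K_{1,h}\cup(h+1)K_1$. Consequently, the prediction (Conjecture 2 of Chang--Li--Zhang) that every maximizer of the adjacency spectral radius over $\mathcal{L}_{\mathcal{H}}^{2}(n,k,\delta)$, for $n$ large relative to $\delta$, is of this matching-core form is false for every pair $(k,\delta)$ with $k\ge 3$ and $k+2\le\delta\le 2k-1$.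
   Context: All graphs are finite, simple and undirected; $\rho(G)$ denotes the adjacency spectral radius of $G$. Here $h=\delta-k$. Family $\mathcal{L}_{\mathcal{H}}^{2}(n,k,\delta)$: it consists of all graphs $G$ (up to isomorphism) obtained as follows. Take pairwise disjoint vertex sets $X,W,Y$ with $|X|=2h+2$, $|W|=k-h-1$, $|Y|=n-k-h-1$. Choose a connected graph $H$ with vertex set $X$ and exactly $\binom{2h+2}{2}-h$ edges. Start from the graph $K_W\vee(H\cup K_Y)$, where $K_W,K_Y$ are the complete graphs on $W,Y$ ($K_\varnothing$ is the empty graph), $\cup$ is disjoint union and $\vee$ is the graph join. Then add a set $B$ of exactly $2h$ edges, each joining a vertex of $X$ to a vertex of $Y$, in such a way that every vertex of $X$ has degree at least $\delta$ in the resulting graph $G$. The missing-edge graph $M$ of such a graph is the graph on $X$ with $E(M)=E(K_X)\setminus E(H)$; its edges are called missing edges. $N_Y(x)$ is the set of neighbors of $x\in X$ in $Y$. $G^\star_{h,k,n}$ (for $h\ge2$) is the member of the family with missing-edge graph $K_{1,h}\cup(h+1)K_1$ in which, with $c$ the center of the star and $\ell_1,\dots,\ell_h$ its leaves, $N_Y(c)=\{y_1,\dots,y_h\}$ for distinct $y_1,\dots,y_h\in Y$, $N_Y(\ell_i)=\{y_1\}$ for all $i$, and the other vertices of $X$ have no neighbor in $Y$. *)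

(* Defs.v *)
From HB Require Import structures.
From mathcomp Require Import all_boot all_order all_algebra.
From mathcomp Require Import reals complex.

Set Implicit Arguments.
Unset Strict Implicit.
Unset Printing Implicit Defensive.

Import Order.TTheory GRing.Theory Num.Theory.

Record sgraph := SGraph {
  vertex :> finType;
  adj : rel vertex;
  adj_sym : symmetric adj;
  adj_irrefl : irreflexive adj }.

Definition isomorphic (G G' : sgraph) : Prop :=
  exists2 f : G -> G', bijective f & forall u v, adj (f u) (f v) = adj u v.

Definition nedges (G : sgraph) : nat :=
  #|[set [set p.1; p.2] | p : G * G & adj p.1 p.2]|.

Definition degree (G : sgraph) (v : G) : nat := #|[set u | adj v u]|.

Definition is_connected (G : sgraph) : Prop :=
  forall u v : G, connect (@adj G) u v.

Section AdjacencySpectrum.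

Variables (R : realType) (G : sgraph).
Local Open Scope ring_scope.

Definition adjacency_mx : 'M[R[i]]_#|G| :=
  \matrix_(i, j) (adj (enum_val i) (enum_val j))%:R.

(* The complex roots of the characteristic polynomial, with multiplicity. *)
Definition spectrum : seq R[i] :=
  sval (closed_field_poly_normal (char_poly adjacency_mx)).

Definition spectral_radius : R :=
  \big[Num.max/0]_(z <- spectrum) ComplexField.Normc.normc z.

End AdjacencySpectrum.

Section Complete.

Variable T : finType.

Definition complete_adj : rel T := fun x y => x != y.

Fact complete_sym : symmetric complete_adj.
Proof. by move=> x y; rewrite /complete_adj eq_sym. Qed.

Fact complete_irrefl : irreflexive complete_adj.
Proof. by move=> x; rewrite /complete_adj eqxx. Qed.

Definition complete : sgraph := SGraph complete_sym complete_irrefl.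

End Complete.

Notation "''K_' n" := (complete 'I_n) (at level 8, n at level 2, format "''K_' n").

Section Complement.

Variable G : sgraph.

Definition complement_adj : rel G := fun x y => (x != y) && ~~ adj x y.

Fact complement_sym : symmetric complement_adj.
Proof. by move=> x y; rewrite /complement_adj eq_sym adj_sym. Qed.

Fact complement_irrefl : irreflexive complement_adj.
Proof. by move=> x; rewrite /complement_adj eqxx. Qed.

Definition complement : sgraph := SGraph complement_sym complement_irrefl.

End Complement.

Section UnionJoin.

Variables G1 G2 : sgraph.

Definition union_adj : rel (G1 + G2)%type := fun u v =>
  match u, v with
  | inl x, inl y => adj x y
  | inr x, inr y => adj x y
  | _, _ => false
  end.

Fact union_sym : symmetric union_adj.
Proof. by move=> [x|x] [y|y] //=; rewrite adj_sym. Qed.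

Fact union_irrefl : irreflexive union_adj.
Proof. by move=> [x|x] /=; rewrite adj_irrefl. Qed.

Definition disjoint_union : sgraph := SGraph union_sym union_irrefl.

Definition join_adj : rel (G1 + G2)%type := fun u v =>
  match u, v with
  | inl x, inl y => adj x y
  | inr x, inr y => adj x y
  | _, _ => true
  end.

Fact join_sym : symmetric join_adj.
Proof. by move=> [x|x] [y|y] //=; rewrite adj_sym. Qed.

Fact join_irrefl : irreflexive join_adj.
Proof. by move=> [x|x] /=; rewrite adj_irrefl. Qed.

Definition join : sgraph := SGraph join_sym join_irrefl.

End UnionJoin.

Section Copies.

Variables (m : nat) (G : sgraph).

Definition copies_adj : rel ('I_m * G)%type :=
  fun u v => (u.1 == v.1) && adj u.2 v.2.

Fact copies_sym : symmetric copies_adj.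
Proof. by move=> u v; rewrite /copies_adj eq_sym adj_sym. Qed.

Fact copies_irrefl : irreflexive copies_adj.
Proof. by move=> u; rewrite /copies_adj adj_irrefl andbF. Qed.

Definition copies : sgraph := SGraph copies_sym copies_irrefl.

End Copies.

Definition star (h : nat) : sgraph := join 'K_1 (copies h 'K_1).

Definition star_missing (h : nat) : sgraph :=
  disjoint_union (star h) (copies h.+1 'K_1).

Definition matching_missing (h : nat) : sgraph :=
  disjoint_union (copies h 'K_2) (copies 2 'K_1).

Section AddEdges.

Variables (G : sgraph) (E : {set G * G}).

Definition add_edges_adj : rel G := fun u v =>
  adj u v || (u != v) && (((u, v) \in E) || ((v, u) \in E)).

Fact add_edges_sym : symmetric add_edges_adj.
Proof.
by move=> u v; rewrite /add_edges_adj adj_sym (eq_sym u) (orbC (_ \in E)).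
Qed.

Fact add_edges_irrefl : irreflexive add_edges_adj.
Proof. by move=> u; rewrite /add_edges_adj adj_irrefl eqxx. Qed.

Definition add_edges : sgraph := SGraph add_edges_sym add_edges_irrefl.

End AddEdges.

Section Construction.

(* [w] and [y] are the sizes of W and Y; X is the vertex set of [H].  An edge
   of B joining x in X to u in Y is encoded as the pair (x, u). *)
Variables (w y : nat) (H : sgraph) (B : {set H * 'I_y}).

Definition base_graph : sgraph := join 'K_w (disjoint_union H 'K_y).

Definition in_X (x : H) : base_graph := inr (inl x).
Definition in_Y (u : 'I_y) : base_graph := inr (inr u).

Definition L2_graph : sgraph :=
  @add_edges base_graph [set (in_X p.1, in_Y p.2) | p in B].

End Construction.

Section Family.

Variables n k delta : nat.
Let h := delta - k.

Definition sizeW : nat := k - h - 1.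
Definition sizeY : nat := n - k - h - 1.

Definition L2_data (H : sgraph) (B : {set H * 'I_sizeY}) : Prop :=
  [/\ #|H| = 2 * h + 2,
      is_connected H,
      nedges H = 'C(2 * h + 2, 2) - h,
      #|B| = 2 * h
    & forall x : H, delta <= @degree (L2_graph sizeW B) (in_X _ _ x)].

Definition L2_graph_of (G H : sgraph) (B : {set H * 'I_sizeY}) : Prop :=
  L2_data B /\ isomorphic G (L2_graph sizeW B).

Definition in_L2 (G : sgraph) : Prop :=
  exists (H : sgraph) (B : {set H * 'I_sizeY}), L2_graph_of G B.

Definition in_L2_with_missing (G M : sgraph) : Prop :=
  exists (H : sgraph) (B : {set H * 'I_sizeY}),
    L2_graph_of G B /\ isomorphic (complement H) M.

Definition matching_core (G : sgraph) : Prop :=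
  exists (H : sgraph) (B : {set H * 'I_sizeY}),
    [/\ L2_graph_of G B,
        isomorphic (complement H) (matching_missing h)
      & exists u : 'I_sizeY, forall x x' : complement H,
          adj x x' -> (x : H, u) \in B].

Definition maximizes_rho (R : realType) (G : sgraph) : Prop :=
  in_L2 G /\
  forall G', in_L2 G' -> (spectral_radius R G' <= spectral_radius R G)%R.

End Family.

Definition matching_core_conjecture (R : realType) (k delta : nat) : Prop :=
  exists N : nat, forall n : nat, N <= n ->
    forall G : sgraph, maximizes_rho n k delta R G -> matching_core n k delta G.

Section StarGraph.

Variables h k n : nat.

(* Vertices of [star_missing h]: [inl (inl _)] is the center c, [inl (inr _)] the
   leaves, [inr _] the isolated vertices.  The vertices y_1, ..., y_h of Y are
   those numbered 0, ..., h - 1. *)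
Definition star_B :
    {set complement (star_missing h) * 'I_(sizeY n k (k + h))} :=
  [set p : complement (star_missing h) * 'I_(sizeY n k (k + h)) |
    match p.1 : star_missing h with
    | inl (inl _) => p.2 < h
    | inl (inr _) => p.2 == 0 :> nat
    | inr _ => false
    end].

Definition Gstar : sgraph := L2_graph (sizeW k (k + h)) star_B.

End StarGraph.

(* Main.v *)
Require Import Defs.
From HB Require Import structures.
From mathcomp Require Import all_boot all_order all_algebra.
From mathcomp Require Import perm sesquilinear spectral reals complex.
From mathcomp Require Import ring lra zify.

(** Why the star wins.  Let M be the missing-edge graph, d(x) the degree of x
    in M, w = |W| and N = |W| + |Y|.  In a member of the family every x of X
    satisfies |N_Y(x)| >= d(x), and both sides sum to 2h over X, so
    |N_Y(x)| = d(x); hence x has D(x) = w + d(x) neighbours in W and Y.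

    Let A be the adjacency matrix of H and Q(x, x') = w + |N_Y(x) /\ N_Y(x')|.
    Since W and Y span a complete graph, their coordinates can be eliminated
    from the eigenvalue equation, which becomes
      t + 1 - N = <D, (t - A - Q/(t+1))^-1 D> / (t + 1).
    The Neumann series of the right-hand side starts with
      E(t) = <D, D>/t + (<D, AD> + <D, QD>/(t+1))/t^2 + <D, A^2 D>/t^3
    and the remainder is of order t^-4.  All the moments are bounded in terms of
    h and w alone, while the spectral radius is at least about N, so for n large
    the order of the radii is decided by comparing the moments
    lexicographically.

    - <D, D> is largest when sum d^2 is.  As any edge of a graph with h edges
      satisfies d(x) + d(x') <= h + 1, sum d^2 <= h (h + 1).
    - If equality holds, every edge has d(x) + d(x') = h + 1, and then
      D(x) D(x') = (w + h) (w + 1) + (d(x) - 1) (d(x') - 1).  Maximizing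
      <D, AD> means minimizing the sum of these products over the edges of M,
      so every edge has an endpoint of degree 1 and M is a star.  (For h = 3 the
      triangle ties with the star in <D, D> and loses here.)
    - Among stars, <D, A^2 D> is constant and <D, QD> is w <D, 1>^2 plus the sum
      over Y of the squared total weight of the neighbours in X.  It is largest
      exactly when all leaves hang on one vertex of Y, which is also a neighbour
      of the center; that determines the graph.

    The series is never summed.  Its truncation extends to a trial vector on the
    whole graph: [spectral_radius_gt_energy] uses it as a Rayleigh test vector
    and [spectral_radius_lt_energy], with a small positive term added, as a
    Collatz-Wielandt test vector.  Both involve N only through N - (t + 1), so
    taking for t the spectral radius of the star graph reduces the comparison to
    [moment_gap] and [energy_gap], where n does not occur.  A matching has
    sum d^2 = 2h < h (h + 1), hence loses at the first step. *)

Set Implicit Arguments.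
Unset Strict Implicit.
Unset Printing Implicit Defensive.

Import Order.TTheory GRing.Theory Num.Theory.

(** * Isomorphisms and bounds on the spectral radius *)

Lemma isomorphic_refl G : isomorphic G G.
Proof. by exists id => //; exists id. Qed.

Lemma isomorphic_sym G G' : isomorphic G G' -> isomorphic G' G.
Proof.
case=> f [g fK gK] fadj; exists g; first by exists f.
by move=> u v; rewrite -{2}[u]gK -{2}[v]gK fadj.
Qed.

Lemma isomorphic_trans G1 G2 G3 :
  isomorphic G1 G2 -> isomorphic G2 G3 -> isomorphic G1 G3.
Proof.
case=> f fbij fadj [g gbij gadj]; exists (g \o f); first exact: bij_comp.
by move=> u v; rewrite /= gadj fadj.
Qed.

Section SpectralRadius.
Local Open Scope ring_scope.
Local Open Scope complex_scope.
Local Open Scope sesquilinear_scope.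

Variables (R : realType) (G : sgraph).

(** Eigenvectors written as functions on the vertices, so that no enumeration
    of the vertex set appears later. *)
Lemma spectrumP (mu : R[i]) :
  mu \in spectrum R G <->
  exists2 f : G -> R[i], (exists v, f v != 0) &
    forall v, \sum_u (adj v u)%:R * f u = mu * f v.
Proof.
have -> : mu \in spectrum R G = eigenvalue (adjacency_mx R G) mu.
  rewrite eigenvalue_root_char /spectrum.
  case: closed_field_poly_normal => s /= sE.
  by rewrite [in RHS]sE (monicP (char_poly_monic _)) scale1r root_prod_XsubC.
split.
  case/eigenvalueP => x /rowP xA x0.
  exists (fun v => x 0 (enum_rank v)).
    apply/existsP; apply: contraNT x0; rewrite negb_exists => /forallP x0.
    apply/eqP/rowP => i; have := x0 (enum_val i).
    by rewrite enum_valK negbK mxE => /eqP.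
  move=> v; have := xA (enum_rank v); rewrite !mxE => <-.
  rewrite [RHS](reindex (@enum_rank G)) /=; last first.
    exact: onW_bij (enum_rank_bij _).
  by apply: eq_bigr => u _; rewrite mxE !enum_rankK adj_sym mulrC.
case=> f [v fv] fA; apply/eigenvalueP.
exists (\row_i f (enum_val i)); last first.
  apply: contraNneq fv => /rowP /(_ (enum_rank v)).
  by rewrite !mxE enum_rankK => ->.
apply/rowP => i; rewrite !mxE -fA.
rewrite [RHS](reindex (@enum_val G G)) /=; last first.
  exact: onW_bij (enum_val_bij _).
by apply: eq_bigr => j _; rewrite !mxE adj_sym mulrC.
Qed.

Lemma spectral_radius_ge mu :
  mu \in spectrum R G -> ComplexField.Normc.normc mu <= spectral_radius R G.
Proof. by move=> mu_in; apply: (le_bigmax_seq 0 mu predT). Qed.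

(** The Collatz-Wielandt upper bound: at a vertex where the ratio |f| / z is
    largest, the eigenvalue equation of f forces |mu| < t. *)
Lemma spectral_radius_lt (t : R) (z : G -> R) :
  0 < t -> (forall v, 0 < z v) ->
  (forall v, \sum_u (adj v u)%:R * z u < t * z v) -> spectral_radius R G < t.
Proof.
move=> t0 z0 zA; rewrite /spectral_radius.
rewrite big_seq; apply: (big_ind (fun x => x < t)) => //.
  by move=> x y xt yt; rewrite gt_max xt.
move=> mu /spectrumP[f [v0 fv0] fA].
pose nf v : R := ComplexField.Normc.normc (f v).
have nfE v : (nf v)%:C = `|f v| by [].
have nf0 v : 0 <= nf v by rewrite -lecR nfE normr_ge0.
pose q v := nf v / z v.
have [v _ vmax] := @arg_maxP _ R G v0 predT q isT.
have qv0 : 0 < q v.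
  apply: lt_le_trans (vmax v0 isT); rewrite divr_gt0 //.
  by rewrite -ltcR nfE normr_gt0.
have : ComplexField.Normc.normc mu * nf v < t * nf v.
  have nfv u : nf u <= q v * z u.
    by rewrite -ler_pdivrMr //; apply: vmax.
  rewrite -ltcR.
  have -> : (ComplexField.Normc.normc mu * nf v)%:C = `|\sum_u (adj v u)%:R * f u|.
    by rewrite fA normrM rmorphM.
  have le1 : `|\sum_u (adj v u)%:R * f u| <= (\sum_u (adj v u)%:R * nf u)%:C.
    apply: le_trans (ler_norm_sum _ _ _) _.
    rewrite rmorph_sum /=; apply: ler_sum => u _.
    rewrite normrM rmorphM normr_nat rmorph_nat -nfE.
    exact: lexx.
  apply: le_lt_trans le1 _; rewrite ltcR.
  apply: (@le_lt_trans _ _ (\sum_u (adj v u)%:R * (q v * z u))).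
    by apply: ler_sum => u _; rewrite ler_wpM2l.
  rewrite (eq_bigr (fun u => q v * ((adj v u)%:R * z u))); last first.
    by move=> u _; rewrite mulrCA.
  rewrite -mulr_sumr; apply: lt_le_trans (_ : q v * (t * z v) <= _).
    by rewrite ltr_pM2l.
  by rewrite mulrCA /q divfK // gt_eqF.
rewrite ltr_pM2r //.
by move: qv0; rewrite /q pmulr_lgt0 // invr_gt0.
Qed.

(** Rayleigh's bound: in an orthonormal eigenbasis <z, Az> is at most the
    spectral radius times <z, z>, whereas the hypotheses give
    <z, Az> > t <z, z>. *)
Lemma spectral_radius_gt (t : R) (z : G -> R) (v0 : G) :
  (forall v, 0 <= z v) -> 0 < z v0 ->
  (forall v, t * z v <= \sum_u (adj v u)%:R * z u) ->
  t * z v0 < \sum_u (adj v0 u)%:R * z u -> t < spectral_radius R G.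
Proof.
move=> z0 zv0 zA zAv0.
set A := adjacency_mx R G.
have Aherm : A \is hermsymmx.
  apply/is_hermitianmxP; rewrite expr0 scale1r.
  apply/matrixP => i j; rewrite !mxE adj_sym.
  by rewrite -[RHS]/(Num.conj _) conjC_nat.
have Anormal : A \is normalmx by apply: hermitian_normalmx.
have /orthomx_spectralP AE := Anormal.
set P := spectralmx A in AE; set d := spectral_diag A in AE.
have PU : P \is unitarymx by apply: spectral_unitarymx.
pose x : 'rV[R[i]]_#|G| := \row_i (z (enum_val i))%:C.
have PE : P *m A = diag_mx d *m P by rewrite {1}AE -mulmxA mulKVmx ?spectral_unit.
(* The rows of P are eigenvectors. *)
have d_spectrum i : d 0 i \in spectrum R G.
  apply/spectrumP; exists (fun v => P i (enum_rank v)).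
    suff /existsP : [exists v, P i (enum_rank v) != 0] by [].
    apply: contraT; rewrite negb_exists => /forallP Pi0.
    have /unitarymxP/matrixP/(_ i i) := PU.
    rewrite !mxE eqxx big1 => [|j _]; first by move/esym/eqP; rewrite oner_eq0.
    have := Pi0 (enum_val j); rewrite enum_valK negbK => /eqP ->.
    by rewrite mul0r.
  move=> v; have /matrixP/(_ i (enum_rank v)) := PE.
  rewrite mul_diag_mx !mxE => <-.
  rewrite [RHS](reindex (@enum_rank G)) /=; last exact: onW_bij (enum_rank_bij _).
  by apply: eq_bigr => u _; rewrite mxE !enum_rankK adj_sym mulrC.
have d_real i : d 0 i = (complex.Re (d 0 i))%:C.
  by rewrite RRe_real //; have /mxOverP := hermitian_spectral_diag_real Aherm.
have d_le i : d 0 i <= (spectral_radius R G)%:C.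
  apply: le_trans (_ : `|d 0 i| <= _).
    by rewrite real_ler_norm // d_real; apply/complex_realP; eexists.
  by rewrite lecR; apply: spectral_radius_ge.
pose y := x *m P ^t*.
(* y holds the coordinates of z in the eigenbasis. *)
have xE : x = y *m P.
  by rewrite /y -mulmxA -invmx_unitary // mulVmx ?spectral_unit ?mulmx1.
have xC : x ^t* = P ^t* *m y ^t* by rewrite xE trmx_mul map_mxM.
have xxE : (x *m x ^t*) 0 0 = \sum_i `|y 0 i| ^+ 2.
  rewrite {1}xE xC mulmxA mulmxtVK // mxE; apply: eq_bigr => i _.
  by rewrite !mxE normCK.
have xAxE : (x *m A *m x ^t*) 0 0 = \sum_i d 0 i * `|y 0 i| ^+ 2.
  rewrite {1}xE -(mulmxA y) PE xC !mulmxA mulmxtVK // mxE.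
  apply: eq_bigr => i _; rewrite mul_mx_diag !mxE normCK.
  by rewrite [d 0 i * _]mulrC mulrAC.
have xx_sum : (x *m x ^t*) 0 0 = (\sum_v z v ^+ 2)%:C.
  rewrite mxE rmorph_sum /= (reindex (@enum_rank G)) /=; last first.
    exact: onW_bij (enum_rank_bij _).
  by apply: eq_bigr => v _; rewrite !mxE enum_rankK rmorphXn /= -normCK ger0_norm ?ler0c.
have xAx_sum : (x *m A *m x ^t*) 0 0 =
    (\sum_v z v * \sum_u (adj v u)%:R * z u)%:C.
  rewrite mxE rmorph_sum /= (reindex (@enum_rank G)) /=; last first.
    exact: onW_bij (enum_rank_bij _).
  apply: eq_bigr => v _; rewrite !mxE enum_rankK rmorphM rmorph_sum /=.
  rewrite mulrC conj_Creal; last by apply/complex_realP; eexists.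
  congr (_ * _); rewrite (reindex (@enum_rank G)) /=; last first.
    exact: onW_bij (enum_rank_bij _).
  by apply: eq_bigr => u _; rewrite !mxE !enum_rankK rmorphM rmorph_nat mulrC adj_sym.
have xAx_le : (x *m A *m x ^t*) 0 0 <= (spectral_radius R G)%:C * (x *m x ^t*) 0 0.
  rewrite xAxE xxE mulr_sumr; apply: ler_sum => i _.
  by rewrite ler_wpM2r // exprn_ge0.
rewrite xx_sum xAx_sum -rmorphM /= lecR in xAx_le.
have zz0 : 0 < \sum_v z v ^+ 2.
  rewrite (bigD1 v0) //= ltr_pwDl ?exprn_gt0 //.
  by apply: sumr_ge0 => v _; rewrite exprn_ge0.
rewrite -(ltr_pM2r zz0); apply: lt_le_trans xAx_le.
rewrite mulr_sumr (bigD1 v0) //= [ltRHS](bigD1 v0) //=.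
have step v : t * z v ^+ 2 = z v * (t * z v) by rewrite mulrCA.
apply: ltr_leD; first by rewrite step ltr_pM2l.
by apply: ler_sum => v _; rewrite step ler_wpM2l.
Qed.

End SpectralRadius.

Lemma isomorphic_spectral_radius (R : realType) G G' :
  isomorphic G G' -> spectral_radius R G = spectral_radius R G'.
Proof.
have le H H' : isomorphic H H' -> (spectral_radius R H <= spectral_radius R H')%R.
  case=> f fbij fadj; rewrite {1}/spectral_radius big_seq.
  apply: (big_ind (fun x => x <= spectral_radius R H')%R).
  - by apply: bigmax_ge_id.
  - by move=> x y xl yl; rewrite ge_max xl.
  move=> mu /spectrumP[g [v gv] gA]; apply: spectral_radius_ge.
  have [f' fK f'K] := fbij.
  apply/spectrumP; exists (g \o f'); first by exists (f v); rewrite /= fK.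
  move=> w; rewrite /= -gA (reindex f) /=; last exact: onW_bij.
  by apply: eq_bigr => u _; rewrite fK -{1}[w]f'K fadj.
move=> iso; apply/eqP; rewrite eq_le !le //; exact: isomorphic_sym.
Qed.

(** * Trial vectors on a member of the family *)

Ltac nonneg := repeat first
  [ done | by apply: ltW | apply: addr_ge0 | apply: mulr_ge0 | apply: exprn_ge0].

Section L2Adjacency.
Variables (w y : nat) (H : sgraph) (B : {set H * 'I_y}).

Lemma L2_adj (u v : L2_graph w B) :
  adj u v = match u, v with
            | inr (inl x), inr (inl x') => adj x x'
            | inr (inl x), inr (inr j) => (x, j) \in B
            | inr (inr j), inr (inl x) => (x, j) \in B
            | _, _ => u != v
            end.
Proof.
have inBE u' v' : ((u', v') \in
    [set (in_X w y p.1, in_Y w H p.2) | p in B]) =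
    match u', v' with inr (inl x), inr (inr j) => (x, j) \in B | _, _ => false end.
  apply/imsetP/idP => [[[x j] /= xjB [-> ->]] //|].
  by case: u' v' => [i|[x|j]] [i'|[x'|j']] // xjB; exists (x, j').
rewrite /adj /= /add_edges_adj !inBE.
case: u v => [i|[x|j]] [i'|[x'|j']] //=; rewrite ?andbF ?orbF //.
Qed.

Lemma L2_degree (x : H) :
  degree (in_X w y x : L2_graph w B) =
  (w + degree x + #|[set j | (x, j) \in B]|)%N.
Proof.
rewrite /degree -!sum1_card.
rewrite (eq_bigl (fun v : L2_graph w B => match v with
   inl _ => true | inr (inl x') => adj x x' | inr (inr j) => (x, j) \in B end)).
  rewrite !big_sumType /= -addnA; congr (_ + (_ + _))%N.
  - by rewrite sum1_card card_ord.
  - by apply: eq_bigl => x'; rewrite inE.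
  - by apply: eq_bigl => j; rewrite inE.
by move=> v; rewrite inE L2_adj; case: v => [i|[x'|j]].
Qed.

Local Open Scope ring_scope.
Variable R : realType.
Implicit Types f g u : H -> R.

(** The number D(x) of neighbours of x outside X. *)
Definition baseDeg (x : H) : nat := w + #|[set j | (x, j) \in B]|.

Definition baseDegR (x : H) : R := (baseDeg x)%:R.

Definition adjOp (f : H -> R) (x : H) : R := \sum_x' (adj x x')%:R * f x'.

Definition ySum (f : H -> R) (j : 'I_y) : R := \sum_x ((x, j) \in B)%:R * f x.

(** The matrix Q: walks of length two from X to X through W or Y, which enter
    the reduced eigenvalue equation. *)
Definition coreOp (f : H -> R) (x : H) : R :=
  w%:R * (\sum_x' f x') + \sum_j ((x, j) \in B)%:R * ySum f j.

(** With r = t + 1, the values on W and Y are those for which the eigenvalue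
    equation at such a vertex holds up to one constant, common to all of them. *)
Definition trial (r : R) (u : H -> R) (v : L2_graph w B) : R :=
  match v with
  | inl _ => 1 + (\sum_x u x) / r
  | inr (inl x) => u x
  | inr (inr j) => 1 + ySum u j / r
  end.

Lemma sum_L2 (F : L2_graph w B -> R) :
  \sum_v F v = \sum_(i < w) F (inl i) +
     (\sum_x F (inr (inl x)) + \sum_(j < y) F (inr (inr j))).
Proof. by rewrite big_sumType /= big_sumType. Qed.

Lemma card_nbrs (x : H) :
  #|[set j | (x, j) \in B]|%:R = \sum_j ((x, j) \in B)%:R :> R.
Proof. by rewrite -natr_sum cardsE -sum1_card [in LHS]big_mkcond. Qed.

Lemma sum_ySum u : \sum_j ySum u j = \sum_x #|[set j | (x, j) \in B]|%:R * u x.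
Proof.
rewrite exchange_big /=; apply: eq_bigr => x _.
by rewrite -mulr_suml card_nbrs.
Qed.

Lemma sum_neq (T : finType) (F : T -> R) (a : T) :
  \sum_b (a != b)%:R * F b = \sum_b F b - F a.
Proof.
rewrite [in RHS](bigD1 a) //= addrAC subrr add0r [RHS]big_mkcond /=.
by apply: eq_bigr => b _; rewrite eq_sym; case: eqP; rewrite ?mul0r ?mul1r.
Qed.

(** The eigenvalue equation for t fails by the same amount at every vertex of W
    and Y; its vanishing is the equation that determines t. *)
Lemma trial_core (t : R) u (v : L2_graph w B) : t + 1 != 0 ->
  (if v is inr (inl _) then false else true) ->
  \sum_v' (adj v v')%:R * trial (t + 1) u v' =
  t * trial (t + 1) u v +
  ((w + y)%:R - (t + 1) + (\sum_x baseDegR x * u x) / (t + 1)).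
Proof.
move=> r0; set r := t + 1.
have Dsum : \sum_x baseDegR x * u x = w%:R * (\sum_x u x) + \sum_j ySum u j.
  rewrite sum_ySum mulr_sumr -big_split; apply: eq_bigr => x _ /=.
  by rewrite /baseDegR natrD mulrDl.
rewrite Dsum sum_L2.
have sumW : \sum_(i < w) trial r u (inl i) = w%:R * (1 + (\sum_x u x) / r).
  by rewrite sumr_const card_ord -[LHS]mulr_natl.
have sumY : \sum_(j < y) trial r u (inr (inr j)) = y%:R + (\sum_j ySum u j) / r.
  by rewrite big_split /= sumr_const card_ord mulr_suml.
case: v => [i|[x|j]] // _.
- transitivity ((w%:R * (1 + (\sum_x u x) / r) - trial r u (inl i)) +
     (\sum_x u x + (y%:R + (\sum_j ySum u j) / r))).
    rewrite -sumW -sumY -(sum_neq (fun i' => trial r u (inl i'))).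
    by congr (_ + (_ + _)); apply: eq_bigr => v' _; rewrite L2_adj ?mul1r.
  rewrite /= natrD /r; field.
  by rewrite -/r.
- transitivity (w%:R * (1 + (\sum_x u x) / r) + (ySum u j +
     ((y%:R + (\sum_j ySum u j) / r) - trial r u (inr (inr j))))).
    rewrite -sumW -sumY -(sum_neq (fun j' => trial r u (inr (inr j')))).
    by congr (_ + (_ + _)); apply: eq_bigr => v' _; rewrite L2_adj ?mul1r.
  rewrite /= natrD /r; field.
  by rewrite -/r.
Qed.

(** At a vertex of X, eliminating W and Y leaves the linear system
    D + A u + Q u / r = t u. *)
Lemma trial_X (r : R) u x :
  \sum_v (adj (in_X w y x : L2_graph w B) v)%:R * trial r u v =
  baseDegR x + adjOp u x + coreOp u x / r.
Proof.
rewrite sum_L2.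
transitivity (\sum_(i < w) (1 + (\sum_x u x) / r) + (adjOp u x +
   \sum_j (((x, j) \in B)%:R + (((x, j) \in B)%:R * ySum u j) / r))).
  congr (_ + (_ + _)); apply: eq_bigr => v' _; rewrite L2_adj ?mul1r //.
  by rewrite /= mulrDr mulr1 mulrA.
rewrite sumr_const card_ord big_split /= -mulr_suml /coreOp /baseDegR natrD.
rewrite card_nbrs.
by rewrite -mulr_natl; ring.
Qed.

Lemma adjOpD f g x : adjOp (fun x => f x + g x) x = adjOp f x + adjOp g x.
Proof. by rewrite -big_split; apply: eq_bigr => x' _; rewrite mulrDr. Qed.

Lemma adjOpZ a f x : adjOp (fun x => a * f x) x = a * adjOp f x.
Proof. by rewrite mulr_sumr; apply: eq_bigr => x' _; rewrite mulrCA. Qed.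

Lemma adjOp_ge0 f x : (forall x, 0 <= f x) -> 0 <= adjOp f x.
Proof. by move=> f0; apply: sumr_ge0 => x' _; rewrite mulr_ge0. Qed.

Lemma ySumD f g j : ySum (fun x => f x + g x) j = ySum f j + ySum g j.
Proof. by rewrite -big_split; apply: eq_bigr => x' _; rewrite mulrDr. Qed.

Lemma ySumZ a f j : ySum (fun x => a * f x) j = a * ySum f j.
Proof. by rewrite mulr_sumr; apply: eq_bigr => x' _; rewrite mulrCA. Qed.

Lemma ySum_ge0 f j : (forall x, 0 <= f x) -> 0 <= ySum f j.
Proof. by move=> f0; apply: sumr_ge0 => x' _; rewrite mulr_ge0. Qed.

Lemma coreOpD f g x : coreOp (fun x => f x + g x) x = coreOp f x + coreOp g x.
Proof.
rewrite /coreOp big_split /= mulrDr addrACA; congr (_ + _).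
by rewrite -big_split; apply: eq_bigr => j _; rewrite ySumD mulrDr.
Qed.

Lemma coreOpZ a f x : coreOp (fun x => a * f x) x = a * coreOp f x.
Proof.
rewrite /coreOp -mulr_sumr mulrDr mulrCA; congr (_ + _).
by rewrite mulr_sumr; apply: eq_bigr => j _; rewrite ySumZ mulrCA.
Qed.

Lemma coreOp_ge0 f x : (forall x, 0 <= f x) -> 0 <= coreOp f x.
Proof.
move=> f0; apply: addr_ge0; first by rewrite mulr_ge0 ?sumr_ge0.
by apply: sumr_ge0 => j _; rewrite mulr_ge0 ?ySum_ge0.
Qed.

Lemma sum_le_card (T : finType) (F : T -> R) m :
  (forall a, F a <= m) -> \sum_a F a <= #|T|%:R * m.
Proof.
move=> Fm; apply: le_trans (_ : \sum_(a : T) m <= _); first exact: ler_sum.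
by rewrite sumr_const mulr_natl.
Qed.

Lemma adjOp_le f m x : 0 <= m -> (forall x, f x <= m) ->
  adjOp f x <= #|H|%:R * m.
Proof.
move=> m0 fm; rewrite /adjOp; apply: sum_le_card => x'.
by case: adj; rewrite ?mul1r ?mul0r.
Qed.

Lemma coreOp_le f m x : 0 <= m -> (forall x, f x <= m) ->
  coreOp f x <= baseDegR x * #|H|%:R * m.
Proof.
move=> m0 fm; rewrite -mulrA /baseDegR natrD mulrDl; apply: lerD.
  by apply: ler_wpM2l => //; apply: sum_le_card.
rewrite card_nbrs mulr_suml; apply: ler_sum => j _.
case: (_ \in B); rewrite ?mul0r // !mul1r /ySum.
apply: sum_le_card => x'.
by case: (_ \in B); rewrite ?mul1r ?mul0r.
Qed.

Lemma baseDegR_ge0 x : 0 <= baseDegR x.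
Proof. exact: ler0n. Qed.

(** The coefficients of the Neumann series of <D, (t - A - Q/(t+1))^-1 D>. *)
Definition degMoment := \sum_x baseDegR x * baseDegR x.
Definition adjMoment := \sum_x baseDegR x * adjOp baseDegR x.
Definition coreMoment := \sum_x baseDegR x * coreOp baseDegR x.
Definition adj2Moment := \sum_x baseDegR x * adjOp (adjOp baseDegR) x.
Definition energy (t : R) :=
  degMoment / t + (adjMoment + coreMoment / (t + 1)) / t ^+ 2 + adj2Moment / t ^+ 3.

(** The truncated Neumann series at s = 1/t and q = 1/(t+1), plus a constant
    correction of order s^4.  Of the terms of order s^3 only A^2 D is kept:
    those involving Q carry a further factor q and go into the remainder. *)
Definition neumann (s q c : R) (x : H) : R :=
  s * baseDegR x + (s ^+ 2 * (adjOp baseDegR x + q * coreOp baseDegR x) +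
   (s ^+ 3 * adjOp (adjOp baseDegR) x + c * s ^+ 4 * 1)).

Lemma sum_neumann (t c : R) : 0 < t ->
  \sum_x baseDegR x * neumann t^-1 (t + 1)^-1 c x =
  energy t + c * (\sum_x baseDegR x) / t ^+ 4.
Proof.
move=> t0; have r0 : t + 1 != 0 by rewrite gt_eqF // ltr_wpDl // ltW.
rewrite /energy /degMoment /adjMoment /coreMoment /adj2Moment.
rewrite mulrDl -[X in _ + X / _ + _]mulr1.
rewrite (mulrAC (\sum_x _ * coreOp _ _)).
rewrite !(mulr_suml, mulr_sumr) -!big_split /=.
apply: eq_bigr => x _; rewrite /neumann; field.
by rewrite r0 gt_eqF.
Qed.

(** For c = 0 truncation leaves nonnegative terms of order s^3, so the vector is a
    subsolution; the correction contributes - c s^3 up to order s^4, which makes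
    it a supersolution as soon as c dominates those terms. *)
Lemma neumann_residual (t c : R) x : t != 0 ->
  let s := t^-1 in let q := (t + 1)^-1 in
  let D := baseDegR in
  D x + adjOp (neumann s q c) x + coreOp (neumann s q c) x / (t + 1)
    - t * neumann s q c x =
  q * s ^+ 2 * (adjOp (coreOp D) x + coreOp (adjOp D) x + q * coreOp (coreOp D) x)
  + s ^+ 3 * (adjOp (adjOp (adjOp D)) x + q * coreOp (adjOp (adjOp D)) x)
  + c * s ^+ 4 * (adjOp (fun=> 1) x + q * coreOp (fun=> 1) x) - c * s ^+ 3.
Proof.
move=> t0 s q D; rewrite /neumann !(adjOpD, adjOpZ, coreOpD, coreOpZ) -/q -/D.
have ts : t * s = 1 by rewrite mulfV.
have -> : t * (s * D x + (s ^+ 2 * (adjOp D x + q * coreOp D x) +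
   (s ^+ 3 * adjOp (adjOp D) x + c * s ^+ 4 * 1))) =
   (t * s) * (D x + (s * (adjOp D x + q * coreOp D x) +
   (s ^+ 2 * adjOp (adjOp D) x + c * s ^+ 3 * 1))) by ring.
by rewrite ts; ring.
Qed.

Lemma spectral_radius_gt_energy (t : R) : 0 < t -> (0 < y)%N ->
  0 < (w + y)%:R - (t + 1) + energy t / (t + 1) ->
  t < spectral_radius R (L2_graph w B).
Proof.
move=> t0 y0 pos.
have r0 : 0 < t + 1 by rewrite ltr_wpDl // ltW.
pose u := neumann t^-1 (t + 1)^-1 0.
have D0 := baseDegR_ge0.
have AD0 x : 0 <= adjOp baseDegR x by apply: adjOp_ge0.
have QD0 x : 0 <= coreOp baseDegR x by apply: coreOp_ge0.
have AAD0 x : 0 <= adjOp (adjOp baseDegR) x by apply: adjOp_ge0.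
have s0 : 0 <= t^-1 by rewrite invr_ge0 ltW.
have q0 : 0 <= (t + 1)^-1 by rewrite invr_ge0 ltW.
have u0 x : 0 <= u x.
  by rewrite /u /neumann; nonneg.
have sumu0 : 0 <= \sum_x u x by apply: sumr_ge0.
have zpos (v : L2_graph w B) : (if v is inr (inl _) then false else true) ->
    0 < trial (t + 1) u v.
  case: v => [i|[x|j]] //= _; apply: ltr_pwDl => //.
    exact: mulr_ge0.
  by rewrite mulr_ge0 ?ySum_ge0.
have core (v : L2_graph w B) : (if v is inr (inl _) then false else true) ->
    t * trial (t + 1) u v < \sum_v' (adj v v')%:R * trial (t + 1) u v'.
  move=> vP; rewrite trial_core ?gt_eqF // ltrDl sum_neumann // mul0r mul0r addr0.
  exact: pos.
pose v0 : L2_graph w B := inr (inr (Ordinal y0)).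
apply: (@spectral_radius_gt _ _ _ (trial (t + 1) u) v0).
- by move=> v; case vE: v => [i|[x|j]]; [apply/ltW/zpos|exact: u0|apply/ltW/zpos].
- exact: zpos.
- move=> v; case vE: v => [i|[x|j]]; [by apply/ltW/core| |by apply/ltW/core].
  rewrite trial_X -subr_ge0 [trial _ _ _]/= neumann_residual ?gt_eqF //.
  rewrite !mul0r subr0 addr0.
  have AQD0 : 0 <= adjOp (coreOp baseDegR) x by apply: adjOp_ge0.
  have QAD0 : 0 <= coreOp (adjOp baseDegR) x by apply: coreOp_ge0.
  have QQD0 : 0 <= coreOp (coreOp baseDegR) x by apply: coreOp_ge0.
  have AAAD0 : 0 <= adjOp (adjOp (adjOp baseDegR)) x by apply: adjOp_ge0.
  have QAAD0 : 0 <= coreOp (adjOp (adjOp baseDegR)) x by apply: coreOp_ge0.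
  by nonneg.
- exact: core.
Qed.

(** A value of c that makes [neumann] a supersolution: in units of s^3, the
    truncation leaves at most 3 p^3 + 2 p^4 when p bounds D and the row sums of A
    and Q, and A and Q applied to the correction cost at most half of it. *)
Definition slack (p : R) : R := 4 * (3 * p ^+ 3 + 2 * p ^+ 4 + 1).

Lemma spectral_radius_lt_energy (p t : R) : 1 <= p -> 4 * p <= t ->
  #|H|%:R <= p -> (forall x, baseDegR x * #|H|%:R <= p) ->
  (forall x, baseDegR x <= p) ->
  (w + y)%:R - (t + 1) +
    (energy t + slack p * (\sum_x baseDegR x) / t ^+ 4) / (t + 1) < 0 ->
  spectral_radius R (L2_graph w B) < t.
Proof.
move=> p1 tp Hp DHp Dp neg.
have p0 : 0 < p by apply: lt_le_trans p1.
have t0 : 0 < t by apply: lt_le_trans tp; rewrite mulr_gt0.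
have r0 : 0 < t + 1 by rewrite ltr_wpDl // ltW.
set c := slack p in neg.
have c0 : 0 < c.
  by rewrite /c /slack mulr_gt0 // ltr_wpDl // addr_ge0 // mulr_ge0 // exprn_ge0 // ltW.
pose u := neumann t^-1 (t + 1)^-1 c.
have D0 := baseDegR_ge0.
have AD0 x : 0 <= adjOp baseDegR x by apply: adjOp_ge0.
have QD0 x : 0 <= coreOp baseDegR x by apply: coreOp_ge0.
have AAD0 x : 0 <= adjOp (adjOp baseDegR) x by apply: adjOp_ge0.
have s0 : 0 < t^-1 by rewrite invr_gt0.
have q0 : 0 < (t + 1)^-1 by rewrite invr_gt0.
have u0 x : 0 < u x.
  rewrite /u /neumann; apply: ltr_wpDl; first by rewrite mulr_ge0 // ltW.
  apply: ltr_wpDl; first by nonneg.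
  apply: ltr_wpDl; first by nonneg.
  by rewrite mulr1 mulr_gt0 // exprn_gt0.
have u0' x : 0 <= u x by apply: ltW.
have sumu0 : 0 <= \sum_x u x by apply: sumr_ge0.
have core (v : L2_graph w B) : (if v is inr (inl _) then false else true) ->
    \sum_v' (adj v v')%:R * trial (t + 1) u v' < t * trial (t + 1) u v.
  move=> vP; rewrite trial_core ?gt_eqF // gtrDl sum_neumann //.
apply: (@spectral_radius_lt _ _ _ (trial (t + 1) u)) => //.
  case=> [i|[x|j]] //=; apply: ltr_pwDl => //.
    by rewrite mulr_ge0 // ltW.
  by rewrite mulr_ge0 ?ySum_ge0 // ltW.
move=> v; case vE: v => [i|[x|j]]; [by apply/core| |by apply/core].
rewrite trial_X -subr_lt0 [trial _ _ _]/= neumann_residual ?gt_eqF //.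
have Ale f m x' : 0 <= m -> (forall x, f x <= m) -> adjOp f x' <= p * m.
  by move=> m_0 fm; apply: le_trans (adjOp_le _ m_0 fm) _; rewrite ler_wpM2r.
have Qle f m x' : 0 <= m -> (forall x, f x <= m) -> coreOp f x' <= p * m.
  by move=> m_0 fm; apply: le_trans (coreOp_le _ m_0 fm) _; rewrite ler_wpM2r.
have pp0 : 0 <= p * p by rewrite mulr_ge0 // ltW.
have ppp0 : 0 <= p * (p * p) by rewrite mulr_ge0 // ltW.
have AD x' : adjOp baseDegR x' <= p * p by apply: Ale => //; apply: ltW.
have QD x' : coreOp baseDegR x' <= p * p by apply: Qle => //; apply: ltW.
have AAD x' : adjOp (adjOp baseDegR) x' <= p * (p * p) by apply: Ale.
have AQD : adjOp (coreOp baseDegR) x <= p * (p * p) by apply: Ale.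
have QAD : coreOp (adjOp baseDegR) x <= p * (p * p) by apply: Qle.
have QQD : coreOp (coreOp baseDegR) x <= p * (p * p) by apply: Qle.
have AAAD : adjOp (adjOp (adjOp baseDegR)) x <= p * (p * (p * p)) by apply: Ale.
have QAAD : coreOp (adjOp (adjOp baseDegR)) x <= p * (p * (p * p)) by apply: Qle.
have A1 : adjOp (fun=> 1) x <= p by rewrite -[p]mulr1; apply: Ale.
have Q1 : coreOp (fun=> 1) x <= p by rewrite -[p]mulr1; apply: Qle.
have Q1' : 0 <= coreOp (fun=> 1 : R) x by apply: coreOp_ge0.
have QQD0 : 0 <= coreOp (coreOp baseDegR) x by apply: coreOp_ge0.
have QAAD0 : 0 <= coreOp (adjOp (adjOp baseDegR)) x by apply: coreOp_ge0.
have qs : (t + 1)^-1 <= t^-1 by rewrite lef_pV2 ?posrE // lerDl.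
have q1 : (t + 1)^-1 <= 1 by rewrite invf_le1 // lerDr ltW.
have sp : t^-1 * (4 * p) <= 1 by rewrite mulrC ler_pdivrMr // mul1r.
set s := t^-1 in s0 qs sp *; set q := (t + 1)^-1 in q0 qs q1 *.
have qle a b : 0 <= a -> a <= b -> q * a <= b.
  by move=> a0 ab; apply: le_trans ab; rewrite -[leRHS]mul1r ler_wpM2r.
(* e1 and e2 are what the truncation leaves, e3 is A + q Q applied to the
   correction. *)
set e1 := adjOp (coreOp _) x + _ + _.
set e2 := adjOp (adjOp _) x + _.
set e3 := adjOp _ x + _.
have E1 : e1 <= 3 * p ^+ 3.
  have := qle _ _ QQD0 QQD; rewrite /e1; move: AQD QAD.
  have -> : p * (p * p) = p ^+ 3 by ring.
  lra.
have E10 : 0 <= e1.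
  have QD1 : 0 <= coreOp (adjOp baseDegR) x by apply: coreOp_ge0.
  have AQD0 : 0 <= adjOp (coreOp baseDegR) x by apply: adjOp_ge0.
  by rewrite /e1; nonneg.
have E2 : e2 <= 2 * p ^+ 4.
  have := qle _ _ QAAD0 QAAD; rewrite /e2; move: AAAD.
  have -> : p * (p * (p * p)) = p ^+ 4 by ring.
  lra.
have E3 : e3 <= 2 * p.
  have := qle _ _ Q1' Q1; rewrite /e3; lra.
have T1 : q * s ^+ 2 * e1 <= s ^+ 3 * (3 * p ^+ 3).
  apply: ler_pM => //; first by rewrite mulr_ge0 ?exprn_ge0 ?ltW.
  by rewrite [leRHS]exprS ler_wpM2r // exprn_ge0 // ltW.
have T2 : s ^+ 3 * e2 <= s ^+ 3 * (2 * p ^+ 4).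
  by rewrite ler_wpM2l // exprn_ge0 // ltW.
have T3 : c * s ^+ 4 * e3 <= s ^+ 3 * (c / 2).
  have -> : c * s ^+ 4 * e3 = s ^+ 3 * (c * (s * e3)) by ring.
  apply: ler_wpM2l; first by nonneg.
  apply: ler_wpM2l; first by nonneg.
  apply: le_trans (_ : s * (2 * p) <= _); first by apply: ler_wpM2l => //; apply: ltW.
  lra.
apply: le_lt_trans (_ : s ^+ 3 * (3 * p ^+ 3 + 2 * p ^+ 4 + c / 2 - c) < 0).
  by move: T1 T2 T3; clear; lra.
rewrite pmulr_rlt0 ?exprn_gt0 // /c /slack.
have : 0 <= p ^+ 3 by rewrite exprn_ge0 // ltW.
have : 0 <= p ^+ 4 by rewrite exprn_ge0 // ltW.
lra.
Qed.

End L2Adjacency.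

(** * Degrees in the missing-edge graph *)

Section Degrees.
Implicit Type G : sgraph.

Lemma degreeE G (x : G) : degree x = \sum_x' adj x x'.
Proof. by rewrite /degree cardsE -sum1_card big_mkcond. Qed.

(** Each edge is the image of exactly two ordered adjacent pairs. *)
Lemma handshake G : \sum_(x : G) degree x = (nedges G).*2.
Proof.
have -> : \sum_(x : G) degree x = \sum_(p : G * G | adj p.1 p.2) 1.
  rewrite (eq_bigr (fun x : G => \sum_(x' | adj x x') 1)); last first.
    by move=> x _; rewrite degreeE [RHS]big_mkcond.
  by rewrite pair_big_dep.
pose P := [set p : G * G | adj p.1 p.2].
rewrite (eq_bigl (fun p => p \in P)); last by move=> p; rewrite inE.
rewrite (partition_big_imset (fun p : G * G => [set p.1; p.2])) /=.
have -> : nedges G = #|[set [set p.1; p.2] | p in P]|.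
  by rewrite /nedges; congr #|pred_of_set _|.
rewrite -muln2 -sum_nat_const; apply: eq_bigr => e /imsetP[[x x'] /=].
rewrite inE /= => xx' ->.
rewrite sum1dep_card.
have -> : [set p in P | [set p.1; p.2] == [set x; x']] = [set (x, x'); (x', x)].
  apply/setP => -[u v]; rewrite !inE /= !xpair_eqE.
  apply/andP/orP.
    case=> uv /eqP e2.
    have : u \in [set x; x'] by rewrite -e2 set21.
    have : v \in [set x; x'] by rewrite -e2 set22.
    rewrite !inE => /orP[]/eqP vE /orP[]/eqP uE; subst u v;
      rewrite ?adj_irrefl ?eqxx // in uv *; by [left | right].
  case=> /andP[/eqP -> /eqP ->]; first by rewrite eqxx.
  by rewrite adj_sym xx' setUC eqxx.
rewrite cards2 xpair_eqE; case: eqP => // xE.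
by rewrite xE adj_irrefl in xx'.
Qed.

Lemma degree_complement G (x : G) :
  degree x + @degree (complement G) x = #|G|.-1.
Proof.
rewrite degreeE (@degreeE (complement G) x) -big_split /=.
rewrite -sum1_card (bigD1 x) // [in RHS](bigD1 x) //= adj_irrefl complement_irrefl.
by apply: eq_bigr => x' x'x; rewrite /complement_adj eq_sym x'x; case: adj.
Qed.
(** Edges at x or x', counted at their other endpoint. *)
Lemma sum_degree_other (M : sgraph) (x x' : M) : x != x' ->
  \sum_(p : M | (p != x) && (p != x')) (adj p x + adj p x') + (adj x x').*2 =
  degree x + degree x'.
Proof.
move=> xx'.
have sumE z : degree z = \sum_(p : M) adj p z.
  by rewrite degreeE; apply: eq_bigr => p _; rewrite adj_sym.
rewrite !sumE -big_split [RHS](bigD1 x) // [in RHS](bigD1 x') 1?eq_sym //=.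
by rewrite !adj_irrefl (adj_sym x' x); lia.
Qed.

End Degrees.

Section Size.
Variables (M : sgraph) (h : nat).
Hypothesis size_M : \sum_(x : M) degree x = h.*2.

(** All h edges are counted by the degrees, and those meeting x or x' number
    degree x + degree x' - 1. *)
Lemma degree_edge_le (x x' : M) : adj x x' -> degree x + degree x' <= h.+1.
Proof.
move=> axx'.
have xx' : x != x' by apply: contraTneq axx' => ->; rewrite adj_irrefl.
have := sum_degree_other xx'; rewrite axx' => sumE.
have le : \sum_(p : M | (p != x) && (p != x')) (adj p x + adj p x') <=
          \sum_(p : M | (p != x) && (p != x')) degree p.
  apply: leq_sum => p _.
  by rewrite degreeE (bigD1 x) //= (bigD1 x') /= 1?eq_sym //; lia.
move: size_M; rewrite (bigD1 x) //= (bigD1 x') /= 1?eq_sym // => s.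
move: s sumE le; set s1 := bigop.body _ _ _; set s2 := bigop.body _ _ _.
lia.
Qed.

Definition star_at (c : M) := degree c = h /\ forall x x' : M, adj x x' -> x = c \/ x' = c.

Lemma sum_over_edges (F : M -> nat) :
  \sum_(x : M) \sum_x' adj x x' * (F x + F x') = (\sum_x degree x * F x).*2.
Proof.
have E : \sum_(x : M) \sum_x' adj x x' * F x = \sum_x degree x * F x.
  by apply: eq_bigr => x _; rewrite degreeE big_distrl.
rewrite -addnn -{1}E -E [in X in _ = _ + X]exchange_big -big_split /=.
apply: eq_bigr => x _; rewrite -big_split /=; apply: eq_bigr => x' _.
by rewrite (adj_sym x' x) mulnDr.
Qed.

Lemma sum_edges_const (a : nat) : \sum_(x : M) \sum_x' adj x x' * a = h.*2 * a.
Proof.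
rewrite -size_M big_distrl; apply: eq_bigr => x _.
by rewrite degreeE big_distrl.
Qed.

(** sum d^2 is the sum of d(x) + d(x') over the edges, and the defect of each
    edge from h + 1 is a natural number. *)
Lemma sum_degree_sq :
  (\sum_(x : M) degree x * degree x).*2 +
  \sum_(x : M) \sum_x' adj x x' * (h.+1 - (degree x + degree x')) = h.*2 * h.+1.
Proof.
rewrite -sum_over_edges -sum_edges_const -big_split; apply: eq_bigr => x _ /=.
rewrite -big_split; apply: eq_bigr => x' _ /=.
case axx' : (adj x x') => //; have := degree_edge_le axx'; lia.
Qed.

Lemma sum_edges_eq0 (F : M -> M -> nat) :
  \sum_(x : M) \sum_x' adj x x' * F x x' = 0 ->
  forall x x', adj x x' -> F x x' = 0.
Proof.
move/eqP; rewrite sum_nat_eq0 => /forallP/= F0 x x' axx'.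
move: (F0 x); rewrite sum_nat_eq0 => /forallP /(_ x') /=.
by rewrite axx' mul1n => /eqP.
Qed.

(** Either some edge has a defect in [degree_edge_le], or some edge has both
    endpoints of degree at least 2, or all edges share an endpoint: an edge with
    a leaf x' and d(x) + d(x') = h + 1 leaves no edge that avoids x. *)
Lemma degree_trichotomy (w : nat) : 0 < h ->
  [\/ \sum_(x : M) degree x * degree x < h * h.+1,
      \sum_(x : M) degree x * degree x = h * h.+1 /\
      h.*2 * ((w + h) * (w + 1)) <
      \sum_(x : M) \sum_x' adj x x' * ((w + degree x) * (w + degree x'))
    | exists c, star_at c].
Proof.
move=> h0; have sq := sum_degree_sq.
case: (ltnP (\sum_(x : M) degree x * degree x) (h * h.+1)) => sqh.
  by constructor 1.
have def0 : \sum_(x : M) \sum_x' adj x x' * (h.+1 - (degree x + degree x')) = 0.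
  by move: sq sqh; set a := bigop.body _ _ _; set b := bigop.body _ _ _; nia.
have sqE : \sum_(x : M) degree x * degree x = h * h.+1.
  by move: sq; rewrite def0; lia.
have edge (x x' : M) : adj x x' -> degree x + degree x' = h.+1.
  by move=> axx'; have := sum_edges_eq0 def0 axx'; have := degree_edge_le axx'; lia.
have degpos (x x' : M) : adj x x' -> 0 < degree x.
  by move=> axx'; rewrite degreeE (bigD1 x') //= axx'.
(* If a + b = h + 1 then (w + a)(w + b) = (w + h)(w + 1) + (a - 1)(b - 1). *)
have prodE : \sum_(x : M) \sum_x' adj x x' * ((w + degree x) * (w + degree x')) =
   h.*2 * ((w + h) * (w + 1)) +
   \sum_(x : M) \sum_x' adj x x' * ((degree x).-1 * (degree x').-1).
  rewrite -sum_edges_const -big_split; apply: eq_bigr => x _ /=.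
  rewrite -big_split; apply: eq_bigr => x' _ /=.
  case axx' : (adj x x') => //; have := edge _ _ axx'.
  have := degpos _ _ axx'; rewrite adj_sym in axx'; have := degpos _ _ axx'.
  case: (degree x) => // a; case: (degree x') => // b _ _ ab /=.
  have -> : h = a + b.+1 by lia.
  nia.
case: (posnP (\sum_(x : M) \sum_x' adj x x' * ((degree x).-1 * (degree x').-1))) => pr.
  constructor 3.
  have leaf (x x' : M) : adj x x' -> degree x = 1 \/ degree x' = 1.
    move=> axx'; have := sum_edges_eq0 pr axx'; have := degpos _ _ axx'.
    rewrite adj_sym in axx'; have := degpos _ _ axx'.
    case: (degree x) => // -[|a]; case: (degree x') => // -[|b] //; by [left | right].
  have center (x x' : M) : adj x x' -> degree x' = 1 -> star_at x.
    move=> axx' dx'; have dx : degree x = h by have := edge _ _ axx'; lia.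
    split=> // p p' app'.
    (* Away from x the degrees add up to h, and so do the edges towards x. *)
    have others : \sum_(q : M | q != x) (degree q - adj q x) = 0.
      have sumx : \sum_(q : M | q != x) adj q x = h.
        rewrite -dx degreeE [RHS](bigD1 x) //= adj_irrefl.
        by apply: eq_bigr => q _; rewrite adj_sym.
      have : \sum_(q : M | q != x) (degree q - adj q x) + h = h.
        rewrite -{1}sumx -big_split /=.
        rewrite (eq_bigr (fun q : M => degree q)); last first.
          by move=> q qx; rewrite subnK // degreeE (bigD1 x) //= leq_addr.
        by apply/eqP; rewrite -(eqn_add2l h) -{1}dx addnn -size_M [eqbRHS](bigD1 x).
      by lia.
    have [->|px] := eqVneq p x; first by left.
    right; move/eqP: others; rewrite sum_nat_eq0 => /forallP /(_ p).
    rewrite px subn_eq0 /= degreeE (bigD1 p') //= app'.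
    have [-> //|p'x] := eqVneq p' x.
    by rewrite (bigD1 x) /= 1?eq_sym //; case: (adj p x) => //=.
  have /existsP[x dx] : [exists x : M, degree x != 0].
    apply: contraTT h0; rewrite negb_exists => /forallP d0.
    rewrite -double_gt0 -size_M big1 // => x _.
    by have := d0 x; rewrite negbK => /eqP.
  have /existsP[x' axx'] : [exists x', adj x x'].
    apply: contraNT dx; rewrite negb_exists => /forallP a0.
    by rewrite degreeE big1 // => x' _; rewrite (negbTE (a0 x')).
  case: (leaf _ _ axx') => d1; last by exists x; apply: center axx' d1.
  by exists x'; apply: (center x' x) d1; rewrite adj_sym.
constructor 2; split => //; rewrite prodE.
by rewrite -addn1 leq_add2l.
Qed.

Section Star.
Variable c : M.
Hypothesis star_c : star_at c.

Lemma star_adj (x x' : M) :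
  adj x x' = (x == c) && adj c x' || (x' == c) && adj c x.
Proof.
case: (eqVneq x c) => [->|xc]; case: (eqVneq x' c) => [->|x'c] //=.
- by rewrite orbb.
- by rewrite orbF.
- by rewrite adj_sym.
- by apply/negP => /(proj2 star_c)[] E; [rewrite E eqxx in xc | rewrite E eqxx in x'c].
Qed.

Lemma star_degree (x : M) : degree x = if x == c then h else adj c x.
Proof.
case: eqVneq => [->|xc]; first by case: star_c.
rewrite degreeE (bigD1 c) //= big1 ?addn0 1?adj_sym // => x' x'c.
by rewrite star_adj (negbTE xc) (negbTE x'c).
Qed.

Lemma star_sum_sq : \sum_(x : M) degree x * degree x = h * h.+1.
Proof.
have := sum_degree_sq; rewrite [X in _ + X]big1 => [|x _]; first lia.
rewrite big1 // => x' _; case axx': adj => //; rewrite !star_degree.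
move: axx'; rewrite star_adj; case: (eqVneq x c) => [->|xc];
  case: (eqVneq x' c) => [->|x'c] /=; rewrite ?adj_irrefl // ?orbF => ->; lia.
Qed.

Lemma star_missing_weight w :
  \sum_(x : M) \sum_x' adj x x' * ((w + degree x) * (w + degree x')) =
  h.*2 * ((w + h) * (w + 1)).
Proof.
rewrite -sum_edges_const.
apply: eq_bigr => x _; apply: eq_bigr => x' _.
case axx': adj => //; rewrite !star_degree.
move: axx'; rewrite star_adj; case: (eqVneq x c) => [->|xc];
  case: (eqVneq x' c) => [->|x'c] /=; rewrite ?adj_irrefl // ?orbF => ->; lia.
Qed.

End Star.
End Size.

(** * Moments, and their values when the missing edges form a star *)

(** The missing edges are what <D, AD> lacks to be <D, 1>^2 - <D, D>. *)
Definition missing_weight w (M : sgraph) :=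
  \sum_(x : M) \sum_x' adj x x' * ((w + degree x) * (w + degree x')).

Section StarFunctions.
Variables (R : realType) (h : nat) (M : sgraph) (c : M).
Hypothesis card_M : #|M| = 2 * h + 2.
Hypothesis star_c : star_at h c.
Local Open Scope ring_scope.

(** Functions constant on the center, on the leaves and on the other vertices.
    They are stable under A, so every moment that involves A alone is a function
    of h and w. *)
Definition starfun (a b g : R) (x : M) : R :=
  if x == c then a else if adj c x then b else g.

Lemma sum_starfun a b g :
  \sum_x starfun a b g x = a + h%:R * b + (h + 1)%:R * g.
Proof.
rewrite (bigD1 c) //= {1}/starfun eqxx -addrA; congr (_ + _).
rewrite (eq_bigr (fun x : M => (adj c x)%:R * b + (1 - (adj c x)%:R) * g)); last first.
  by move=> x /negbTE xc; rewrite /starfun xc; case: adj => /=; ring.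
have sumL : \sum_(x : M | x != c) (adj c x)%:R = h%:R :> R.
  rewrite -natr_sum -(proj1 star_c) degreeE [in RHS](bigD1 c) //=.
  by rewrite adj_irrefl.
rewrite big_split /= -!mulr_suml sumL sumrB sumL sumr_const; congr (_ + _ * _).
rewrite cardC1 card_M -natrB; last by lia.
by congr (_%:R); lia.
Qed.

Lemma miss_starfun a b g x :
  \sum_x' (adj x x')%:R * starfun a b g x' = starfun (h%:R * b) a 0 x.
Proof.
rewrite {2}/starfun; case: (eqVneq x c) => [->|xc].
  rewrite (eq_bigr (fun x' : M => (adj c x')%:R * b)); last first.
    move=> x' _; rewrite /starfun; case: eqVneq => [->|_].
      by rewrite adj_irrefl !mul0r.
    by case: adj; rewrite ?mul0r.
  by rewrite -mulr_suml -natr_sum -(degreeE) (proj1 star_c).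
rewrite (bigD1 c) //= big1 => [|x' x'c].
  by rewrite addr0 /starfun eqxx adj_sym; case: adj; rewrite ?mul0r ?mul1r.
by rewrite (star_adj star_c) (negbTE xc) (negbTE x'c) mul0r.
Qed.

Lemma sum_starfunM a b g a' b' g' :
  \sum_x starfun a b g x * starfun a' b' g' x =
  a * a' + h%:R * (b * b') + (h + 1)%:R * (g * g').
Proof.
rewrite -sum_starfun; apply: eq_bigr => x _; rewrite /starfun.
by case: eqP => // _; case: ifP.
Qed.

End StarFunctions.

Section StarNeighbours.
Variables (h w y : nat) (M : sgraph) (B : {set M * 'I_y}).
Hypothesis degB : forall x : M, #|[set j | (x, j) \in B]| = degree x.

(** <D, QD> is w <D, 1>^2 plus the sum of the squares of these weights, as
    D(x) = w + d(x). *)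
Definition nbrWeight (j : 'I_y) : nat := \sum_(x : M) ((x, j) \in B) * (w + degree x).

Variable c : M.
Hypothesis star_c : star_at h c.
Definition leafCount (j : 'I_y) : nat := \sum_(x : M | adj c x) ((x, j) \in B).

Lemma nbrWeightE j :
  (nbrWeight j = (w + h) * ((c, j) \in B) + (w + 1) * leafCount j)%N.
Proof.
rewrite /nbrWeight (bigD1 c) //= (star_degree star_c) eqxx mulnC; congr (_ + _)%N.
rewrite /leafCount big_distrr /= [RHS]big_mkcond /= [RHS](bigD1 c) //=.
rewrite adj_irrefl add0n; apply: eq_bigr => x xc.
rewrite (star_degree star_c) (negbTE xc); case cx: adj; first by rewrite mulnC.
suff -> : ((x, j) \in B) = false by [].
apply/negP => xjB; have := degB x; rewrite (star_degree star_c) (negbTE xc) cx.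
by move=> /eqP; rewrite cards_eq0 => /eqP/setP/(_ j); rewrite !inE xjB.
Qed.

Lemma sum_mem_B x : (\sum_j ((x, j) \in B) = degree x)%N.
Proof. by rewrite -degB cardsE -sum1_card [RHS]big_mkcond. Qed.

Lemma sum_leafCount : (\sum_j leafCount j = h)%N.
Proof.
rewrite exchange_big /= -[RHS](proj1 star_c) degreeE.
rewrite big_mkcond /=; apply: eq_bigr => x _; case cx: adj => //.
rewrite sum_mem_B (star_degree star_c) cx; case: eqP => // xc.
by rewrite xc adj_irrefl in cx.
Qed.

Lemma leafCount_le j : (leafCount j <= h)%N.
Proof. by rewrite -[leqRHS]sum_leafCount (bigD1 j) //= leq_addr. Qed.

(** The sum of squares when one vertex of Y sees the center and all leaves and
    h - 1 further ones see only the center. *)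
Definition star_nbr_max : nat :=
  (h * (w + h) ^ 2 + 2 * h * (w + h) * (w + 1) + h ^ 2 * (w + 1) ^ 2)%N.

(** With C and T the numbers of the center and of leaves at j, this expands
    ((w+h) C + (w+1) T)^2 using C T = T - (1 - C) T and T^2 = h T - T (h - T);
    both corrections are nonnegative. *)
Lemma star_nbrWeight :
  (\sum_j nbrWeight j * nbrWeight j +
   (2 * (w + h) * (w + 1) * (\sum_j (1 - ((c, j) \in B)) * leafCount j) +
    (w + 1) ^ 2 * (\sum_j leafCount j * (h - leafCount j))) = star_nbr_max)%N.
Proof.
have -> : star_nbr_max = ((w + h) ^ 2 * (\sum_j ((c, j) \in B)) +
   2 * (w + h) * (w + 1) * (\sum_j leafCount j) +
   (w + 1) ^ 2 * (h * (\sum_j leafCount j)))%N.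
  by rewrite sum_mem_B sum_leafCount (star_degree star_c) eqxx /star_nbr_max; nia.
rewrite !big_distrr /= -!big_split /=; apply: eq_bigr => j _.
rewrite nbrWeightE; have := leafCount_le j; set T := leafCount j => Th.
(* Without truncated subtraction both cases are polynomial identities. *)
have hE : h = (T + (h - T))%N by lia.
move: (h - T)%N hE => e hE; rewrite hE !expnS !expn0.
by case: (_ \in B) => /=; lia.
Qed.

(** Equality makes T (h - T) and (1 - C) T vanish everywhere, so one vertex of Y
    sees all leaves, and sees the center too. *)
Lemma star_dichotomy : (0 < h)%N ->
  (\sum_j nbrWeight j * nbrWeight j < star_nbr_max)%N \/
  exists2 j0 : 'I_y, (c, j0) \in B &
    forall x : M, adj c x -> forall j, ((x, j) \in B) = (j == j0).
Proof.
move=> h0; have E := star_nbrWeight.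
set s1 := (\sum_j (1 - _) * _)%N in E; set s2 := (\sum_j _ * (h - _))%N in E.
have [z|] := posnP (s1 + s2)%N; last by left; nia.
right; have {z E} [s10 s20] : s1 = 0%N /\ s2 = 0%N by lia.
have zero (F : 'I_y -> nat) : (\sum_j F j = 0)%N -> forall j, F j = 0%N.
  by move/eqP; rewrite sum_nat_eq0 => /forallP F0 j; apply/eqP/(F0 j).
have s1j := zero _ s10; have s2j := zero _ s20.
have /existsP[j0 j0P] : [exists j, leafCount j != 0%N].
  apply: contraTT h0; rewrite negb_exists => /forallP n0.
  by rewrite -sum_leafCount big1 // => j _; apply/eqP; rewrite -[_ == _]negbK.
have full : leafCount j0 = h.
  by have := s2j j0; have := leafCount_le j0; nia.
exists j0; first by move: (s1j j0); case: (_ \in B) => //=; lia.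
move=> x cx j.
have xc : x != c by apply: contraTneq cx => ->; rewrite adj_irrefl.
have xj0 : (x, j0) \in B.
  apply: contraTT isT => xj0.
  have := full; rewrite -(proj1 star_c) degreeE [in RHS](bigD1 x) //= cx.
  rewrite /leafCount (bigD1 x) //= (negbTE xj0) add0n => E.
  suff : (\sum_(i : M | adj c i && (i != x)) ((i, j0) \in B) <=
          \sum_(i : M | i != x) adj c i)%N by rewrite E; lia.
  rewrite big_mkcond [X in (_ <= X)%N]big_mkcond; apply: leq_sum => i _.
  by case: (adj c i) => //=; case: (i != x) => //; case: (_ \in B).
have := sum_mem_B x; rewrite (star_degree star_c) (negbTE xc) cx (bigD1 j0) //= xj0.
case: eqVneq => [-> //|jj0]; rewrite (bigD1 j) //=.
by case: (_ \in B) => //=; lia.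
Qed.

End StarNeighbours.

Section Moments.
Variables (R : realType) (h w y : nat) (H : sgraph) (B : {set H * 'I_y}).
Let M := complement H.
Hypothesis card_H : #|H| = 2 * h + 2.
Hypothesis size_M : \sum_(x : M) degree x = h.*2.
Hypothesis degB : forall x : H, #|[set j | (x, j) \in B]| = @degree M x.

Let card_M : #|M| = 2 * h + 2 := card_H.
Local Notation d x := (@degree M x).
Local Notation D := (baseDegR w B R).

Lemma baseDegE x : baseDeg w B x = w + d x.
Proof. by rewrite /baseDeg degB. Qed.

Local Open Scope ring_scope.

Lemma adjE (x x' : H) :
  (adj x x')%:R = 1 - (x == x')%:R - (@adj M x x')%:R :> R.
Proof.
rewrite -[@adj M x x']/((x != x') && ~~ adj x x').
by case: eqP => [->|_]; rewrite ?adj_irrefl; [|case: adj] => /=; ring.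
Qed.

Lemma adjOpE (f : H -> R) x :
  adjOp f x = \sum_x' f x' - f x - \sum_x' (@adj M x x')%:R * f x'.
Proof.
have E x' : (adj x x')%:R * f x' =
    f x' - ((x == x')%:R * f x' + (@adj M x x')%:R * f x').
  by rewrite adjE; ring.
rewrite /adjOp (eq_bigr _ (fun x' _ => E x')) sumrB big_split /= opprD addrA.
congr (_ - _ - _); rewrite (bigD1 x) //= eqxx mul1r big1 ?addr0 // => x'.
by rewrite eq_sym => /negbTE ->; rewrite mul0r.
Qed.

Lemma sum_baseDeg : \sum_x D x = (w * (2 * h + 2) + 2 * h)%:R.
Proof.
rewrite -natr_sum; congr (_%:R).
rewrite (eq_bigr (fun x : H => w + d x)%N) => [|x _]; last exact: baseDegE.
by rewrite big_split /= sum_nat_const card_H size_M; lia.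
Qed.

Lemma degMomentE : degMoment w B R =
  (w ^ 2 * (2 * h + 2) + 4 * w * h)%:R + (\sum_(x : M) degree x * degree x)%:R.
Proof.
rewrite /degMoment /baseDegR (eq_bigr (fun x => ((w + d x) * (w + d x))%:R)); last first.
  by move=> x _; rewrite baseDegE natrM.
rewrite -natr_sum -natrD; congr (_%:R).
rewrite (eq_bigr (fun x : H => w ^ 2 + 2 * w * d x + d x * d x)%N); last by move=> x _; nia.
rewrite !big_split /= sum_nat_const card_H -big_distrr /= size_M; lia.
Qed.

Lemma adjMomentE : adjMoment w B R =
  (\sum_x D x) ^+ 2 - degMoment w B R - (missing_weight w M)%:R.
Proof.
rewrite /adjMoment /degMoment expr2 mulr_suml -sumrB /missing_weight natr_sum -sumrB.
apply: eq_bigr => x _; rewrite adjOpE !mulrBr; congr (_ - _).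
rewrite mulr_sumr natr_sum; apply: eq_bigr => x' _.
by rewrite /baseDegR !baseDegE !natrM mulrCA.
Qed.

Lemma coreMomentE : coreMoment w B R =
  w%:R * (\sum_x D x) ^+ 2 + (\sum_j @nbrWeight w y M B j * @nbrWeight w y M B j)%:R.
Proof.
rewrite /coreMoment /coreOp.
rewrite (eq_bigr (fun x => w%:R * (\sum_x' D x') * D x +
   \sum_j (((x, j) \in B)%:R * D x) * ySum B D j)); last first.
  move=> x _; rewrite mulrDr; congr (_ + _); first by rewrite mulrC.
  by rewrite mulr_sumr; apply: eq_bigr => j _; ring.
rewrite big_split /= -mulr_sumr -mulrA -expr2; congr (_ + _).
rewrite exchange_big natr_sum; apply: eq_bigr => j _ /=.
have E : ySum B D j = (@nbrWeight w y M B j)%:R.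
  by rewrite /ySum natr_sum; apply: eq_bigr => x _; rewrite /baseDegR baseDegE natrM.
by rewrite -mulr_suml -/(ySum B D j) E natrM.
Qed.

Section Star.
Variable c : M.
Hypothesis star_c : star_at h c.

Lemma adjOp_starfun a b g x :
  let S := a + h%:R * b + (h + 1)%:R * g in
  @adjOp H R (@starfun R M c a b g) x =
  (@starfun R M c) (S - a - h%:R * b) (S - b - a) (S - g) x.
Proof.
rewrite /= adjOpE (sum_starfun card_M star_c) (miss_starfun star_c) /starfun.
by case: eqP => // _; case: ifP => _; rewrite ?subr0.
Qed.

Lemma baseDeg_starfun x : D x = (@starfun R M c) (w + h)%:R (w + 1)%:R w%:R x.
Proof.
rewrite /baseDegR baseDegE (@star_degree M h c star_c x) /starfun.
by case: eqP => // _; case: adj; rewrite ?addn0.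
Qed.

Lemma eq_adjOp (f g : H -> R) : f =1 g -> adjOp f =1 adjOp g.
Proof. by move=> fg x; apply: eq_bigr => x' _; rewrite fg. Qed.

Definition star_adj2Moment : R :=
  let a := (w + h)%:R in let b := (w + 1)%:R in let g := w%:R in
  let S := a + h%:R * b + (h + 1)%:R * g in
  let a' := S - a - h%:R * b in let b' := S - b - a in let g' := S - g in
  let S' := a' + h%:R * b' + (h + 1)%:R * g' in
  a * (S' - a' - h%:R * b') + h%:R * (b * (S' - b' - a')) + (h + 1)%:R * (g * (S' - g')).

Lemma star_adj2MomentE : adj2Moment w B R = star_adj2Moment.
Proof.
rewrite /adj2Moment /star_adj2Moment /= -(sum_starfunM card_M star_c); apply: eq_bigr => x _.
congr (_ * _); first exact: baseDeg_starfun.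
have E x' := etrans (eq_adjOp baseDeg_starfun x') (adjOp_starfun _ _ _ x').
by rewrite (eq_adjOp E) adjOp_starfun.
Qed.

End Star.
End Moments.

(** Each later moment carries an additional factor 1/t or 1/(t+1) and is at most
    E <= t/6, so a unit gap at the first moment that differs prevails. *)
Lemma energy_gap (R : realType) (t E a0 a1 b a2 c a0' a1' b' a2' : R) :
  (1 <= E -> 6 * E <= t -> 0 <= a1' -> 0 <= b' -> 0 <= a2' ->
  0 <= b -> b <= E -> a1 <= E -> a2 <= E -> 0 <= a2 -> 0 <= c -> c <= E ->
  [\/ a0 + 1 <= a0', a0 = a0' /\ a1 + 1 <= a1'
    | [/\ a0 = a0', a1 = a1', a2 = a2' & b + 1 <= b']] ->
  a0 / t + (a1 + b / (t + 1)) / t ^+ 2 + a2 / t ^+ 3 + c / t ^+ 4 <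
  a0' / t + (a1' + b' / (t + 1)) / t ^+ 2 + a2' / t ^+ 3)%R.
Proof.
move=> E1 tE a1'0 b'0 a2'0 b0 bE a1E a2E a20 c0 cE gap.
have E0 : (0 < E)%R by lra.
have t0 : (0 < t)%R by lra.
have q0 : (0 < (t + 1)^-1)%R by rewrite invr_gt0; lra.
have s0 : (0 < t^-1)%R by rewrite invr_gt0.
have qs : ((t + 1)^-1 <= t^-1)%R by rewrite lef_pV2 ?posrE; lra.
have sq : (t^-1 <= 2 * (t + 1)^-1)%R.
  by rewrite ler_pdivlMr ?ler_pdivrMl; lra.
have sE : (t^-1 * (6 * E) <= 1)%R by rewrite mulrC ler_pdivrMr // mul1r.
rewrite -!exprVn.
set s := (t^-1)%R in s0 qs sq sE *; set q := ((t + 1)^-1)%R in q0 qs sq *.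
have sEle a : (a <= E -> s * a <= 6^-1)%R.
  move=> aE; apply: (@le_trans _ _ (s * E)%R); first by rewrite ler_wpM2l // ltW.
  lra.
have s1 : (s <= 6^-1)%R by have := sEle _ E1; lra.
have sa1 := sEle _ a1E; have sb := sEle _ bE.
have sa2 := sEle _ a2E; have sc := sEle _ cE.
have sb' : (q * b <= 6^-1)%R by apply: le_trans sb; rewrite ler_wpM2r.
have ss : (0 <= s * s)%R by rewrite mulr_ge0 // ltW.
have ub e : (e <= 6^-1 -> s * e <= 6^-1 * s)%R.
  by move=> e6; rewrite mulrC ler_wpM2r // ltW.
have qb0 : (0 <= q * b')%R by rewrite mulr_ge0 // ltW.
have ssb' : (0 <= s * (q * b'))%R by rewrite mulr_ge0 // ltW.
have sa1' : (0 <= s * a1')%R by rewrite mulr_ge0 // ltW.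
have ssa2' : (0 <= s * (s * a2'))%R by rewrite !mulr_ge0 // ltW.
have sssc : (s * (s * (s * c)) <= 6^-1 * s)%R.
  by apply: (ub); apply: le_trans (ub _ sc) _; lra.
case: gap => [g0|[-> g1]|[-> -> -> gb]].
- rewrite -subr_gt0.
  have -> : (a0' * s + (a1' + b' * q) * s ^+ 2 + a2' * s ^+ 3 -
    (a0 * s + (a1 + b * q) * s ^+ 2 + a2 * s ^+ 3 + c * s ^+ 4) =
    s * ((a0' - a0) + s * a1' + s * (q * b') + s * (s * a2') -
         (s * a1 + s * (q * b) + s * (s * a2) + s * (s * (s * c)))))%R by ring.
  rewrite mulr_gt0 //; have := ub _ sb'; have := ub _ sa2; lra.
- rewrite -subr_gt0.
  have -> : (a0' * s + (a1' + b' * q) * s ^+ 2 + a2' * s ^+ 3 -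
    (a0' * s + (a1 + b * q) * s ^+ 2 + a2 * s ^+ 3 + c * s ^+ 4) =
    s * s * ((a1' - a1) + q * b' + s * a2' -
         (q * b + s * a2 + s * (s * c))))%R by ring.
  have sa20 : (0 <= s * a2')%R by rewrite mulr_ge0 // ltW.
  rewrite !mulr_gt0 //; have := ub _ sc; lra.
- rewrite -subr_gt0.
  have -> : (a0' * s + (a1' + b' * q) * s ^+ 2 + a2' * s ^+ 3 -
    (a0' * s + (a1' + b * q) * s ^+ 2 + a2' * s ^+ 3 + c * s ^+ 4) =
    s * s * (q * (b' - b) - s * (s * c)))%R by ring.
  have qb : (q * 1 <= q * (b' - b))%R by apply: ler_wpM2l; [exact: ltW|lra].
  rewrite !mulr_gt0 //; have := ub _ sc; lra.
Qed.

(** * Comparison of spectral radii *)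

(** The conditions of the family in the form used by the proof; see
    [L2_data_core] and [core_L2_data]. *)
Definition core_data h y (H : sgraph) (B : {set H * 'I_y}) : Prop :=
  [/\ #|H| = 2 * h + 2,
      \sum_(x : complement H) degree x = h.*2
    & forall x : H, #|[set j | (x, j) \in B]| = @degree (complement H) x].

(** The configuration in which all the maxima are attained: a missing star whose
    leaves have the same single neighbour j0 in Y, shared with the center. *)
Definition extremal h y (H : sgraph) (B : {set H * 'I_y})
    (c : complement H) (j0 : 'I_y) : Prop :=
  [/\ star_at h c, (c : H, j0) \in B
    & forall x : complement H, adj c x -> forall j, ((x : H, j) \in B) = (j == j0)].

Lemma extremal_nbrWeight h w y (H : sgraph) (B : {set H * 'I_y}) c j0 :
  core_data h B -> extremal h B c j0 ->
  \sum_j @nbrWeight w y (complement H) B j * @nbrWeight w y (complement H) B j =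
  star_nbr_max h w.
Proof.
case=> _ _ degB [star_c cj0 leaf].
have TE j : @leafCount y (complement H) B c j = h * (j == j0).
  rewrite /leafCount (eq_bigr (fun=> (j == j0) : nat)); last first.
    by move=> x cx; rewrite leaf.
  rewrite sum_nat_cond_const; congr (_ * _).
  exact: (proj1 star_c).
rewrite -(@star_nbrWeight h w y (complement H) B degB c star_c).
rewrite [X in _ * X + _]big1 => [|j _]; last first.
  by rewrite TE; case: (eqVneq j j0) => [->|_]; rewrite ?cj0 ?muln0.
rewrite [X in _ + (_ + _ * X)]big1 ?muln0 ?addn0 // => j _.
by rewrite TE; case: (_ == _) => /=; lia.
Qed.

Section Comparison.
Variables (R : realType) (h w y : nat).
Hypothesis h_gt0 : 0 < h.

(** Bounds D and the row sums of A and Q, whatever the size of Y. *)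
Definition entry_bound : nat := (w + 2 * h) * (2 * h + 2).
Local Notation p := (entry_bound%:R : R)%R.
(** Bounds the moments after the first, and the correction of the supersolution. *)
Definition moment_bound : R := (slack p * p ^+ 2 + p ^+ 5)%R.

Local Open Scope ring_scope.

Lemma entry_bound_ge1 : 1 <= p.
Proof. by rewrite ler1n /entry_bound; lia. Qed.

Section Bounds.
Variables (H : sgraph) (B : {set H * 'I_y}).
Hypothesis data : core_data h B.
Let card_H : #|H| = (2 * h + 2)%N. Proof. by case: data. Qed.
Let size_M : (\sum_(x : complement H) degree x = h.*2)%N. Proof. by case: data. Qed.
Let degB : forall x : H, #|[set j | (x, j) \in B]| = @degree (complement H) x.
Proof. by case: data. Qed.
Local Notation D := (baseDegR w B R).

Lemma baseDeg_le x : (baseDeg w B x <= w + 2 * h)%N.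
Proof.
rewrite (baseDegE w degB) leq_add2l mul2n -size_M.
by rewrite (bigD1 x) //= leq_addr.
Qed.

Lemma card_le : #|H|%:R <= p.
Proof. by rewrite card_H ler_nat /entry_bound; nia. Qed.

Lemma baseDegR_card_le x : D x * #|H|%:R <= p.
Proof.
rewrite /baseDegR -natrM ler_nat card_H /entry_bound leq_mul2r.
by rewrite baseDeg_le orbT.
Qed.

Lemma baseDegR_le x : D x <= p.
Proof.
rewrite /baseDegR ler_nat; apply: leq_trans (baseDeg_le x) _.
by rewrite /entry_bound; nia.
Qed.

Let p0 : 0 <= p. Proof. exact: ler0n. Qed.

Lemma adjOp_bound (f : H -> R) m x : 0 <= m -> (forall x, f x <= m) -> adjOp f x <= p * m.
Proof.
by move=> m0 fm; apply: le_trans (adjOp_le _ m0 fm) _; rewrite ler_wpM2r // card_le.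
Qed.

Lemma coreOp_bound (f : H -> R) m x : 0 <= m -> (forall x, f x <= m) ->
  coreOp w B f x <= p * m.
Proof.
move=> m0 fm; apply: le_trans (coreOp_le _ _ _ m0 fm) _.
by rewrite ler_wpM2r // baseDegR_card_le.
Qed.

Lemma sum_bound (F : H -> R) m : 0 <= m -> (forall x, F x <= m) -> \sum_x F x <= p * m.
Proof.
by move=> m0 Fm; apply: le_trans (sum_le_card Fm) _; rewrite ler_wpM2r // card_le.
Qed.

Lemma moment_bounds :
  [/\ adjMoment w B R <= moment_bound, coreMoment w B R <= moment_bound,
      adj2Moment w B R <= moment_bound
    & slack p * \sum_x D x <= moment_bound].
Proof.
have p1 := entry_bound_ge1.
have D0 := baseDegR_ge0 w B R.
have AD0 x : 0 <= adjOp D x by apply: adjOp_ge0.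
have QD0 x : 0 <= coreOp w B D x by apply: coreOp_ge0.
have AAD0 x : 0 <= adjOp (adjOp D) x by apply: adjOp_ge0.
have AD x : adjOp D x <= p * p by apply: adjOp_bound => // z; apply: baseDegR_le.
have QD x : coreOp w B D x <= p * p by apply: coreOp_bound => // z; apply: baseDegR_le.
have AAD x : adjOp (adjOp D) x <= p * (p * p) by apply: adjOp_bound => //; apply: mulr_ge0.
have slack0 : 0 <= slack p.
  by rewrite /slack mulr_ge0 // !addr_ge0 // mulr_ge0 // exprn_ge0.
have p45 : p ^+ 4 <= p ^+ 5 by apply: ler_weXn2l.
have sp0 : 0 <= slack p * p ^+ 2 by rewrite mulr_ge0 // exprn_ge0.
have p50 : 0 <= p ^+ 5 by rewrite exprn_ge0.
split; rewrite /moment_bound.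
- apply: le_trans (_ : p * (p * (p * p)) <= _); last first.
    have -> : p * (p * (p * p)) = p ^+ 4 by ring.
    lra.
  apply: sum_bound => [|x]; first by rewrite !mulr_ge0.
  by apply: ler_pM => //; apply: baseDegR_le.
- apply: le_trans (_ : p * (p * (p * p)) <= _); last first.
    have -> : p * (p * (p * p)) = p ^+ 4 by ring.
    lra.
  apply: sum_bound => [|x]; first by rewrite !mulr_ge0.
  by apply: ler_pM => //; apply: baseDegR_le.
- apply: le_trans (_ : p * (p * (p * (p * p))) <= _); last first.
    have -> : p * (p * (p * (p * p))) = p ^+ 5 by ring.
    lra.
  apply: sum_bound => [|x]; first by rewrite !mulr_ge0.
  by apply: ler_pM => //; apply: baseDegR_le.
- have : slack p * \sum_x D x <= slack p * p ^+ 2.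
    rewrite ler_wpM2l // expr2; apply: sum_bound => // x; exact: baseDegR_le.
  lra.
Qed.

Lemma moments_ge0 :
  [/\ 0 <= degMoment w B R, 0 <= adjMoment w B R, 0 <= coreMoment w B R
    & 0 <= adj2Moment w B R].
Proof.
have D0 := baseDegR_ge0 w B R.
have AD0 x : 0 <= adjOp D x by apply: adjOp_ge0.
have QD0 x : 0 <= coreOp w B D x by apply: coreOp_ge0.
have AAD0 x : 0 <= adjOp (adjOp D) x by apply: adjOp_ge0.
by split; apply: sumr_ge0 => x _; rewrite mulr_ge0.
Qed.

Lemma energy_ge0 (t : R) : 0 <= t -> 0 <= energy w B t.
Proof.
move=> t0; case: moments_ge0 => ????; rewrite /energy.
have r0 : 0 <= t + 1 by rewrite addr_ge0.
by rewrite !(addr_ge0, divr_ge0) // exprn_ge0.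
Qed.

End Bounds.

Lemma moment_bound_ge : 1 <= moment_bound /\ p <= moment_bound.
Proof.
have p1 := entry_bound_ge1; have p0 : 0 <= p by exact: ler0n.
have p5 : p <= p ^+ 5 by rewrite -[leLHS]expr1; apply: ler_weXn2l.
have : 0 <= slack p * p ^+ 2.
  by rewrite mulr_ge0 ?exprn_ge0 // /slack mulr_ge0 // !addr_ge0 // mulr_ge0 // exprn_ge0.
by rewrite /moment_bound; split; lra.
Qed.

Variables (Hs : sgraph) (Bs : {set Hs * 'I_y}) (cs : complement Hs) (js : 'I_y).
Hypothesis data_s : core_data h Bs.
Hypothesis extremal_s : extremal h Bs cs js.
Hypothesis large : 6 * moment_bound + 1 < (w + y)%:R.

(** The moments are integers, so they cannot differ by less than 1; this is what
    makes the threshold for n uniform over the family. *)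
Lemma moment_gap (H : sgraph) (B : {set H * 'I_y}) : core_data h B ->
  (exists c, exists j0, extremal h B c j0) \/
  [\/ degMoment w B R + 1 <= degMoment w Bs R,
      degMoment w B R = degMoment w Bs R /\ adjMoment w B R + 1 <= adjMoment w Bs R
    | [/\ degMoment w B R = degMoment w Bs R, adjMoment w B R = adjMoment w Bs R,
          adj2Moment w B R = adj2Moment w Bs R
        & coreMoment w B R + 1 <= coreMoment w Bs R]].
Proof.
case=> card_H size_M degB; have [card_Hs size_Ms degBs] := data_s.
have [star_s _ _] := extremal_s.
have nbr_s := extremal_nbrWeight w data_s extremal_s.
rewrite !(adjMomentE R w degB) !(adjMomentE R w degBs).
rewrite !(coreMomentE R w degB) !(coreMomentE R w degBs).
rewrite !(degMomentE R w card_H size_M degB) !(degMomentE R w card_Hs size_Ms degBs).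
rewrite !(sum_baseDeg R w card_H size_M degB) !(sum_baseDeg R w card_Hs size_Ms degBs).
rewrite /missing_weight nbr_s (star_sum_sq size_Ms star_s) (star_missing_weight size_Ms star_s).
have [lt0|[-> lt1]|[c star_c]] := degree_trichotomy size_M w h_gt0.
- by right; constructor 1; rewrite -addrA lerD2l natr1 ler_nat.
- right; constructor 2; split=> //; move: lt1; rewrite -(ler_nat R) -natr1; lra.
rewrite (star_sum_sq size_M star_c) (star_missing_weight size_M star_c).
rewrite (star_adj2MomentE _ _ card_H degB star_c) (star_adj2MomentE _ _ card_Hs degBs star_s).
have [lt|[j0 cj0 leaf]] := @star_dichotomy h w y (complement H) B degB c star_c h_gt0.
- right; constructor 3; split => //; move: lt; rewrite -(ler_nat R) -natr1; lra.
- by left; exists c, j0.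
Qed.

(** At t, the spectral radius of the extremal graph, the lower bound must fail for
    that graph; the energy gap then yields the upper bound for the other one. *)
Lemma extremal_or_lt (H : sgraph) (B : {set H * 'I_y}) : core_data h B ->
  (exists c, exists j0, extremal h B c j0) \/
  spectral_radius R (L2_graph w B) < spectral_radius R (L2_graph w Bs).
Proof.
move=> data; have [|gap] := moment_gap data; first by left.
right; set t := spectral_radius R (L2_graph w Bs).
have [E1 Ep] := moment_bound_ge.
have y0 : (0 < y)%N by case: (y) js => [[]|].
have [s0 s1 s1' s2] := moments_ge0 Bs.
have [n0 n1 n1' n2] := moments_ge0 B.
have [b1 b1' b2 bs] := moment_bounds data.
(* The energy is nonnegative, so at 6 E the size of W and Y is enough for the
   lower bound. *)
have tE : 6 * moment_bound < t.
  have E0 : 0 < 6 * moment_bound by lra.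
  apply: spectral_radius_gt_energy => //.
  apply: ltr_pwDl; first by rewrite subr_gt0.
  by rewrite divr_ge0 ?energy_ge0 //; lra.
have t0 : 0 < t by lra.
have low : (w + y)%:R - (t + 1) + energy w Bs t / (t + 1) <= 0.
  rewrite leNgt; apply/negP => /(spectral_radius_gt_energy t0 y0).
  by rewrite ltxx.
apply: (@spectral_radius_lt_energy _ _ _ _ _ p) => //.
- exact: entry_bound_ge1.
- lra.
- exact: card_le data.
- exact: baseDegR_card_le data.
- exact: baseDegR_le data.
apply: lt_le_trans low; rewrite ltrD2l ltr_pM2r ?invr_gt0; last by lra.
rewrite /energy; apply: (@energy_gap R t moment_bound) => //; first by lra.
rewrite mulr_ge0 ?sumr_ge0 //.
by rewrite /slack mulr_ge0 // !addr_ge0 // mulr_ge0 // exprn_ge0.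
Qed.
End Comparison.

(** * Recovering the graph, and the family in terms of degrees *)

(** The k-th element of a color class is sent to the k-th element of the class
    of the same color. *)
Lemma coloring_bij (T1 T2 C : finType) (f1 : T1 -> C) (f2 : T2 -> C) :
  (forall c, #|[set x | f1 x == c]| = #|[set x | f2 x == c]|) ->
  exists2 phi : T1 -> T2, bijective phi & forall x, f2 (phi x) = f1 x.
Proof.
move=> fib.
pose e1 c := enum [set x | f1 x == c]; pose e2 c := enum [set x | f2 x == c].
have in1 x : x \in e1 (f1 x) by rewrite mem_enum inE.
have /fin_all_exists[phi phiP] x : exists y : T2,
    f2 y = f1 x /\ index y (e2 (f2 y)) = index x (e1 (f1 x)).
  have lt : index x (e1 (f1 x)) < size (e2 (f1 x)).
    by rewrite -cardE -fib cardE index_mem.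
  have y0 : T2 by case: (e2 (f1 x)) lt => // y0.
  have := mem_nth y0 lt; rewrite mem_enum inE => /eqP yE.
  by exists (nth y0 (e2 (f1 x)) (index x (e1 (f1 x)))); rewrite yE index_uniq ?enum_uniq.
exists phi; last by move=> x; case: (phiP x).
apply: inj_card_bij.
  move=> x x' phixx'; have [c1 i1] := phiP x; have [c2 i2] := phiP x'.
  rewrite phixx' in c1 i1; have cE : f1 x = f1 x' by rewrite -c1 -c2.
  rewrite -(nth_index x (in1 x)) -i1 i2 -cE.
  by rewrite nth_index // cE.
rewrite -!sum1_card (partition_big f1 predT) // (partition_big f2 predT) //=.
by apply: eq_leq; apply: eq_bigr => c _; rewrite !sum1dep_card fib.
Qed.

(** By inclusion-exclusion the four cardinals fix the sizes of all the classes of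
    the coloring x |-> (a x, b x). *)
Lemma two_predicates_bij (T1 T2 : finType) (a1 b1 : pred T1) (a2 b2 : pred T2) :
  #|T1| = #|T2| -> #|a1| = #|a2| -> #|b1| = #|b2| ->
  #|[predI a1 & b1]| = #|[predI a2 & b2]| ->
  exists2 phi : T1 -> T2, bijective phi &
    forall x, a2 (phi x) = a1 x /\ b2 (phi x) = b1 x.
Proof.
move=> cT ca cb cab.
have [[a b]|phi phib phiP] :=
  @coloring_bij T1 T2 (bool * bool)%type (fun x => (a1 x, b1 x)) (fun x => (a2 x, b2 x)).
  have class_card (T : finType) (p q : pred T) :
      #|[set x | (p x, q x) == (a, b)]| =
      if a then if b then #|[predI p & q]| else #|p| - #|[predI p & q]|
      else if b then #|q| - #|[predI p & q]| else #|T| - (#|p| + #|q| - #|[predI p & q]|).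
    have Ep := cardID q p; have Eq := cardID p q; have ET := cardC [predU p & q].
    have EU := cardUI p q.
    have C1 : #|[predI q & p]| = #|[predI p & q]| by apply: eq_card => x; rewrite !inE andbC.
    have C2 : #|[predC [predU p & q]]| = #|[set x | (p x, q x) == (false, false)]|.
      by apply: eq_card => x; rewrite !inE xpair_eqE !eqbF_neg negb_or.
    have C3 : #|[predD p & q]| = #|[set x | (p x, q x) == (true, false)]|.
      by apply: eq_card => x; rewrite !inE xpair_eqE eqb_id eqbF_neg andbC.
    have C4 : #|[predD q & p]| = #|[set x | (p x, q x) == (false, true)]|.
      by apply: eq_card => x; rewrite !inE xpair_eqE eqb_id eqbF_neg.
    have C5 : #|[predI p & q]| = #|[set x | (p x, q x) == (true, true)]|.
      by apply: eq_card => x; rewrite !inE xpair_eqE !eqb_id.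
    rewrite C1 in Eq.
    case: (a) (b) => [] []; rewrite -?C2 -?C3 -?C4 -?C5 //.
    - by rewrite -Ep addKn.
    - by rewrite -Eq addKn.
    - by rewrite -EU addnK -ET addKn.
  by rewrite !class_card cT ca cb cab.
by exists phi => // x; have [] := phiP x.
Qed.

Lemma L2_isomorphic w y (H1 H2 : sgraph) (B1 : {set H1 * 'I_y}) (B2 : {set H2 * 'I_y})
    (f : H1 -> H2) (g : 'I_y -> 'I_y) :
  bijective f -> bijective g ->
  (forall x x', adj (f x) (f x') = adj x x') ->
  (forall x j, ((f x, g j) \in B2) = ((x, j) \in B1)) ->
  isomorphic (L2_graph w B1) (L2_graph w B2).
Proof.
move=> fbij gbij fadj fgB.
have finj := bij_inj fbij; have ginj := bij_inj gbij.
have [f' fK f'K] := fbij; have [g' gK g'K] := gbij.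
pose F (v : L2_graph w B1) : L2_graph w B2 := match v with
  inl i => inl i | inr (inl x) => inr (inl (f x)) | inr (inr j) => inr (inr (g j)) end.
pose F' (v : L2_graph w B2) : L2_graph w B1 := match v with
  inl i => inl i | inr (inl x) => inr (inl (f' x)) | inr (inr j) => inr (inr (g' j)) end.
have FK : cancel F F' by case=> [i|[x|j]] //=; rewrite ?fK ?gK.
have F'K : cancel F' F by case=> [i|[x|j]] //=; rewrite ?f'K ?g'K.
exists F; first by exists F'.
move=> u v; rewrite !L2_adj -(inj_eq (can_inj FK) u v).
by case: u v => [i|[x|j]] [i'|[x'|j']] //=.
Qed.

Lemma isomorphic_degree (G G' : sgraph) (f : G -> G') :
  bijective f -> (forall u v, adj (f u) (f v) = adj u v) ->
  forall x, degree (f x) = degree x.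
Proof.
move=> fbij fadj x; rewrite !degreeE (reindex f) /=; last exact: onW_bij.
by apply: eq_bigr => x' _; rewrite fadj.
Qed.

Lemma adj_complement2 (G : sgraph) (x x' : G) :
  @adj (complement (complement G)) x x' = adj x x'.
Proof.
rewrite -[LHS]/((x != x') && ~~ ((x != x') && ~~ adj x x')).
case: (eqVneq x x') => [->|_] /=.
  by rewrite adj_irrefl.
by rewrite negbK.
Qed.

Lemma degree_complement2 (G : sgraph) (x : G) :
  @degree (complement (complement G)) x = degree x.
Proof. by rewrite !degreeE; apply: eq_bigr => x' _; rewrite adj_complement2. Qed.

Section Extremal.
Variables (h y : nat).

(** The vertices without missing edge have no neighbour in Y, because
    |N_Y(x)| = d(x). *)
Lemma extremal_mem (H : sgraph) (B : {set H * 'I_y}) c j0 :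
  core_data h B -> extremal h B c j0 ->
  forall x j, ((x, j) \in B) =
    if x == c then (c : H, j) \in B else (@adj (complement H) c x) && (j == j0).
Proof.
case=> _ _ degB [star_c _ leaf] x j.
case: (eqVneq x c) => [->|xc] //; case cx: (@adj (complement H) c x).
  by rewrite andTb; apply: leaf.
rewrite andFb; apply/negP => xjB; have := degB x.
rewrite (@star_degree _ h c star_c x) (negbTE xc) cx => /eqP.
by rewrite cards_eq0 => /eqP/setP/(_ j); rewrite !inE xjB.
Qed.

(** By [extremal_mem] and [star_adj], adjacency is determined by the roles of the
    vertices, and each role is played by equally many vertices in both graphs. *)
Lemma extremal_isomorphic w (H1 H2 : sgraph) (B1 : {set H1 * 'I_y}) (B2 : {set H2 * 'I_y})
    c1 j1 c2 j2 :
  core_data h B1 -> extremal h B1 c1 j1 ->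
  core_data h B2 -> extremal h B2 c2 j2 ->
  isomorphic (L2_graph w B1) (L2_graph w B2).
Proof.
move=> data1 ext1 data2 ext2.
have [cardH1 _ _] := data1; have [star1 cj1 _] := ext1.
have [cardH2 _ _] := data2; have [star2 cj2 _] := ext2.
have cardadj (H : sgraph) (c : complement H) : star_at h c ->
    #|(fun x : H => @adj (complement H) c x)| = h.
  by case=> <- _; rewrite /degree cardsE.
have cardadj' (H : sgraph) (c : complement H) :
    #|[predI (pred1 (c : H)) & (fun x : H => @adj (complement H) c x)]| = 0.
  by apply: eq_card0 => x; rewrite !inE; case: eqP => //= ->; apply: (@adj_irrefl (complement H)).
have [f fbij fP] := @two_predicates_bij H1 H2 (pred1 (c1 : H1))
  (fun x => @adj (complement H1) c1 x) (pred1 (c2 : H2)) (fun x => @adj (complement H2) c2 x)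
  (etrans cardH1 (esym cardH2)) (etrans (card1 _) (esym (card1 _)))
  (etrans (cardadj _ _ star1) (esym (cardadj _ _ star2)))
  (etrans (cardadj' _ _) (esym (cardadj' _ _))).
have cardY (H : sgraph) (B : {set H * 'I_y}) (c : complement H) : core_data h B ->
    star_at h c -> #|(fun j : 'I_y => (c : H, j) \in B)| = h.
  by case=> _ _ degB [<- _]; rewrite -degB cardsE.
have cardY' (H : sgraph) (B : {set H * 'I_y}) (c : complement H) j : (c : H, j) \in B ->
    #|[predI (pred1 j) & (fun j : 'I_y => (c : H, j) \in B)]| = 1.
  by move=> cj; rewrite -(card1 j); apply: eq_card => i; rewrite !inE; case: eqP => // ->.
have [g gbij gP] := @two_predicates_bij _ _ (pred1 j1)
  (fun j => (c1 : H1, j) \in B1) (pred1 j2) (fun j => (c2 : H2, j) \in B2)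
  erefl (etrans (card1 _) (esym (card1 _)))
  (etrans (cardY _ _ _ data1 star1) (esym (cardY _ _ _ data2 star2)))
  (etrans (cardY' _ _ _ _ cj1) (esym (cardY' _ _ _ _ cj2))).
have eqc x : (f x == c2) = (x == c1) := proj1 (fP x).
have adjc x : @adj (complement H2) c2 (f x) = @adj (complement H1) c1 x := proj2 (fP x).
have eqj j : (g j == j2) = (j == j1) := proj1 (gP j).
apply: (@L2_isomorphic w y H1 H2 B1 B2 f g) => // [x x'|x j].
  rewrite -(adj_complement2 (f x)) -(adj_complement2 x).
  rewrite -[LHS]/((f x != f x') && ~~ @adj (complement H2) (f x) (f x')).
  rewrite -[RHS]/((x != x') && ~~ @adj (complement H1) x x').
  rewrite (inj_eq (bij_inj fbij)) (star_adj star1 x x') (star_adj star2 (f x) (f x')).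
  by rewrite !eqc !adjc.
rewrite (extremal_mem data1 ext1) (extremal_mem data2 ext2) eqc adjc eqj.
by rewrite (proj2 (gP j)).
Qed.
End Extremal.

Section Data.
Variables (n k h : nat).
Hypothesis hk : h < k.
Local Notation y := (Defs.sizeY n k (k + h)).

Lemma sum_card_nbrs y' (T : finType) (B : {set T * 'I_y'}) :
  \sum_x #|[set j | (x, j) \in B]| = #|B|.
Proof.
rewrite -[RHS]sum1_card (eq_bigr (fun x => \sum_(j | (x, j) \in B) 1)); last first.
  by move=> x _; rewrite sum1dep_card.
rewrite pair_big_dep /=; apply: eq_bigl => -[x j] //.
Qed.

Lemma binom2h : 'C(2 * h + 2, 2) = (h + 1) * (2 * h + 1).
Proof.
rewrite bin2; have -> : (2 * h + 2) * (2 * h + 2).-1 = ((h + 1) * (2 * h + 1)).*2 by nia.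
by rewrite doubleK.
Qed.

Lemma sum_degree_complement (H : sgraph) : #|H| = 2 * h + 2 ->
  (nedges H).*2 + \sum_(x : complement H) degree x = (2 * h + 2) * (2 * h + 1).
Proof.
move=> cardH; rewrite -handshake -big_split /=.
rewrite (eq_bigr (fun=> 2 * h + 1)) => [|x _].
  by rewrite sum_nat_const cardH.
by rewrite (@degree_complement H x) cardH; lia.
Qed.

(** The degree condition gives d(x) <= |N_Y(x)|, and the two sides have the same
    sum 2h. *)
Lemma L2_data_core (H : sgraph) (B : {set H * 'I_y}) :
  @L2_data n k (k + h) H B -> core_data h B.
Proof.
rewrite /L2_data addKn => -[cardH _ edgesH cardB degH].
have size_M : \sum_(x : complement H) degree x = h.*2.
  by have := sum_degree_complement cardH; rewrite edgesH binom2h; nia.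
split=> //.
have le (x : H) : @degree (complement H) x <= #|[set j | (x, j) \in B]|.
  have := degH x; rewrite L2_degree /sizeW addKn.
  have := @degree_complement H x; rewrite cardH.
  by move: (degree x) (degree x) #|_| => a b d; lia.
have sumE : \sum_(x : H) (#|[set j | (x, j) \in B]| - @degree (complement H) x) = 0.
  have : \sum_(x : H) (#|[set j | (x, j) \in B]| - @degree (complement H) x) + h.*2 = h.*2.
    rewrite -{1}size_M -big_split /= -[RHS]mul2n -cardB -sum_card_nbrs.
    by apply: eq_bigr => x _; rewrite subnK.
  by lia.
move=> x; apply/eqP; rewrite eqn_leq le andbT -subn_eq0.
by move/eqP: sumE; rewrite sum_nat_eq0 => /forallP /(_ x).
Qed.

(** Two nonadjacent vertices u, v have a common neighbour: otherwise each of the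
    2h other vertices carries a missing edge to u or v; with uv these exceed h. *)
Lemma core_connected (H : sgraph) : #|H| = 2 * h + 2 ->
  \sum_(x : complement H) degree x = h.*2 -> is_connected H.
Proof.
move=> cardH size_M u v; have [->|uv] := eqVneq u v; first exact: connect0.
have [/connect1 //|nuv] := boolP (adj u v).
have [/existsP[z /andP[uz zv]]|no] := boolP [exists z, adj u z && adj z v].
  by apply: connect_trans (connect1 uz) (connect1 zv).
exfalso.
have M_uv : @adj (complement H) u v by rewrite /adj /= /complement_adj uv.
have each (z : H) : z != u -> z != v ->
    0 < @adj (complement H) z u + @adj (complement H) z v.
  move=> zu zv; move: no; rewrite negb_exists => /forallP /(_ z).
  rewrite [@adj (complement H) z u]/adj [@adj (complement H) z v]/adj /= /complement_adj.
  by rewrite zu zv (adj_sym u z); case: adj => //; case: adj.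
have := @sum_degree_other (complement H) u v uv; rewrite M_uv => S.
have := @degree_edge_le (complement H) h size_M u v M_uv; rewrite -ltnS -S.
apply/negP; rewrite -leqNgt.
have : \sum_(p : H | (p != u) && (p != v)) 1 <=
  \sum_(p : complement H | (p != u) && (p != v))
     (@adj (complement H) p u + @adj (complement H) p v).
  by apply: leq_sum => z /andP[zu zv]; apply: each.
rewrite sum1_card.
have : #|H| = 2 + #|[pred p : H | (p != u) && (p != v)]|.
  rewrite (cardD1 u) (cardD1 v) !inE eq_sym uv; congr (_ + (_ + _)).
  by apply: eq_card => p; rewrite !inE andbT andbC.
rewrite cardH; set a := #|_|; set b := bigop.body _ _ _; lia.
Qed.

Lemma core_L2_data (H : sgraph) (B : {set H * 'I_y}) :
  core_data h B -> @L2_data n k (k + h) H B.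
Proof.
case=> cardH size_M degB; rewrite /L2_data addKn; split => //.
- exact: core_connected.
- by have := sum_degree_complement cardH; rewrite size_M binom2h; nia.
- by rewrite -sum_card_nbrs (eq_bigr _ (fun x _ => degB x)) size_M mul2n.
- move=> x; rewrite L2_degree degB /sizeW addKn.
  have := @degree_complement H x; rewrite cardH.
  move: (degree x) (degree x) => a b; lia.
Qed.

End Data.

(** * The star and matching members *)

Lemma sum_unary (F : 'I_1 -> nat) : \sum_i F i = F ord0.
Proof. by rewrite big_ord_recl big_ord0 addn0. Qed.

Lemma sum_prod (T1 T2 : finType) (F : T1 * T2 -> nat) :
  \sum_p F p = \sum_i \sum_j F (i, j).
Proof. by rewrite pair_big /=; apply: eq_bigr => -[]. Qed.

Lemma star_missing_degree h (x : star_missing h) :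
  degree x = match x with inl (inl _) => h | inl (inr _) => 1 | inr _ => 0 end.
Proof.
rewrite degreeE !big_sumType /= !sum_prod.
case: x => [[c|[i a]]|[i a]] /=.
- rewrite sum_unary [c]ord1 /complete_adj eqxx add0n.
  rewrite (eq_bigr (fun=> 1)) => [|i _]; last by rewrite sum_unary.
  by rewrite sum1_card card_ord big1 ?addn0 // => i _; rewrite big1.
- rewrite sum_unary /= big1 => [|i' _]; last first.
    by rewrite sum_unary /copies_adj /= [a]ord1 /complete_adj eqxx andbF.
  by rewrite big1 // => i' _; rewrite big1.
- rewrite sum_unary /= big1 => [|i' _]; last by [].
  rewrite big1 // => i' _; rewrite big1 // => b _.
  by rewrite /copies_adj /= [a]ord1 [b]ord1 /complete_adj eqxx andbF.
Qed.

Lemma card_star_missing h : #|star_missing h| = 2 * h + 2.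
Proof. rewrite /= !card_sum !card_prod !card_ord; lia. Qed.

Lemma sum_star_missing h (F : star_missing h -> nat) :
  \sum_x F x = F (inl (inl ord0)) + \sum_(i < h) F (inl (inr (i, ord0))) +
               \sum_(i < h.+1) F (inr (i, ord0)).
Proof.
rewrite !big_sumType /= !sum_prod sum_unary.
by congr (_ + _ + _); apply: eq_bigr => i _; rewrite sum_unary.
Qed.

Lemma matching_missing_degree h (x : matching_missing h) :
  degree x = match x with inl _ => 1 | inr _ => 0 end.
Proof.
rewrite degreeE big_sumType /= !sum_prod.
case: x => [[i a]|[i a]] /=.
- rewrite [X in _ + X]big1 => [|i' _]; last by rewrite big1.
  rewrite addn0 (bigD1 i) //= [X in _ + X]big1 => [|i' i'i]; last first.
    by rewrite big1 // => b _; rewrite /copies_adj /= eq_sym (negbTE i'i).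
  rewrite addn0 /copies_adj /= eqxx /= !big_ord_recl big_ord0 /complete_adj.
  by case: a => [[|[|]]].
- rewrite big1 => [|i' _]; last by rewrite big1.
  rewrite big1 // => i' _; rewrite big1 // => b _.
  by rewrite /copies_adj /= [a]ord1 [b]ord1 /complete_adj eqxx andbF.
Qed.

Lemma card_matching_missing h : #|matching_missing h| = 2 * h + 2.
Proof. rewrite /= !card_sum !card_prod !card_ord; lia. Qed.

Lemma sum_matching_degree h : \sum_(x : matching_missing h) degree x = h.*2.
Proof.
rewrite (eq_bigr _ (fun x _ => matching_missing_degree x)) big_sumType /=.
by rewrite sum1_card card_prod !card_ord big1 // addn0 muln2.
Qed.

Section Instances.
Variables (n k h : nat).
Hypothesis (h2 : 2 <= h) (hk : h < k) (nk : 2 * (k + h) + 2 <= n).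
Local Notation y := (Defs.sizeY n k (k + h)).

(** Room in Y for the h neighbours of the center. *)
Lemma sizeY_gt : h < y.
Proof. by rewrite /Defs.sizeY addKn; lia. Qed.

Let y_gt0 : 0 < y := leq_ltn_trans (leq0n h) sizeY_gt.
Let y0 : 'I_y := Ordinal y_gt0.

Definition star_center : complement (complement (star_missing h)) := inl (inl ord0).

Lemma star_B_degree (x : star_missing h) :
  #|[set j | (x, j) \in star_B h k n]| = degree x.
Proof.
rewrite star_missing_degree; case: x => [[c|l]|z].
- rewrite (eq_card (B := [set widen_ord (ltnW sizeY_gt) i | i in 'I_h])); last first.
    move=> j; rewrite !inE /=; apply/idP/imsetP => [jh|[i _ ->]] //=.
    by exists (Ordinal jh) => //; apply: val_inj.
  by rewrite card_imset ?card_ord // => i i' /(congr1 val) /= /val_inj.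
- rewrite (eq_card (B := [set y0])) ?cards1 // => j.
  by rewrite !inE /= -val_eqE.
- by apply: eq_card0 => j; rewrite !inE.
Qed.

Lemma star_core : core_data h (star_B h k n).
Proof.
split.
- exact: card_star_missing.
- rewrite (eq_bigr (fun x : star_missing h => degree x)) => [|x _]; last first.
    exact: degree_complement2.
  rewrite sum_star_missing !star_missing_degree.
  rewrite (eq_bigr (fun=> 1)) => [|i _]; last by rewrite star_missing_degree.
  rewrite [X in _ + X]big1 => [|i _]; last by rewrite star_missing_degree.
  by rewrite sum1_card card_ord addn0 addnn.
- by move=> x; rewrite degree_complement2; apply: star_B_degree.
Qed.

Lemma star_extremal : extremal h (star_B h k n) star_center y0.
Proof.
have adjE (x x' : star_missing h) :
  @adj (complement (complement (star_missing h))) x x' = adj x x' := adj_complement2 x x'.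
split.
- split; first by rewrite degree_complement2 star_missing_degree.
  move=> x x'; rewrite adjE /star_center.
  case: x => [[c|l]|[i a]]; case: x' => [[c'|l']|[i' a']] //=.
  + by rewrite [c]ord1; left.
  + by rewrite [c]ord1; left.
  + by rewrite [c']ord1; right.
  + by case: l l' => [i a] [i' a'];
      rewrite /copies_adj /= [a]ord1 [a']ord1 /complete_adj eqxx andbF.
  + by rewrite /copies_adj /= [a]ord1 [a']ord1 /complete_adj eqxx andbF.
- by rewrite inE /=; apply: ltnW.
- move=> x; rewrite adjE; case: x => [[c|l]|z] //=.
    by rewrite [c]ord1.
  by move=> _ j; rewrite inE /= -val_eqE.
Qed.

Definition matching_H : sgraph := complement (matching_missing h).

Definition matching_B : {set matching_H * 'I_y} :=
  [set p : matching_H * 'I_y |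
    (if (p.1 : matching_missing h) is inl _ then true else false) && (p.2 == y0)].

Definition Gmatching : sgraph := L2_graph (sizeW k (k + h)) matching_B.

Lemma matching_core_data : core_data h matching_B.
Proof.
split.
- exact: card_matching_missing.
- rewrite (eq_bigr (fun x : matching_missing h => degree x)) => [|x _]; last first.
    exact: degree_complement2.
  exact: sum_matching_degree.
- move=> x; rewrite degree_complement2 matching_missing_degree.
  case: x => z.
    by apply: etrans (cards1 y0); apply: eq_card => j; rewrite !inE.
  by apply: eq_card0 => j; rewrite !inE.
Qed.

Lemma L2_data_star : L2_data (star_B h k n).
Proof. exact: core_L2_data star_core. Qed.

Lemma complement2_isomorphic (G : sgraph) : isomorphic (complement (complement G)) G.
Proof. by exists id; [exists id|move=> x x'; rewrite adj_complement2]. Qed.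

Lemma Gstar_missing : in_L2_with_missing n k (k + h) (Gstar h k n) (star_missing h).
Proof.
exists _, (star_B h k n); split; last exact: complement2_isomorphic.
by split; [exact: L2_data_star|exact: isomorphic_refl].
Qed.

Lemma Gmatching_core : matching_core n k (k + h) Gmatching.
Proof.
exists matching_H, matching_B; split.
- by split; [exact: (core_L2_data hk matching_core_data)|exact: isomorphic_refl].
- by rewrite addKn; apply: complement2_isomorphic.
- exists y0 => x x'; rewrite adj_complement2 inE eqxx andbT /=.
  by case: x x' => [x|x] [x'|x'] //=; case: x x' => [i a] [i' a'];
    rewrite /copies_adj /= [a]ord1 [a']ord1 /complete_adj eqxx andbF.
Qed.

(** A vertex incident with a missing edge has a single neighbour in Y, which is
    then the common one; a transposition of Y moves it to y0. *)
Lemma matching_core_isomorphic (G : sgraph) :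
  matching_core n k (k + h) G <-> isomorphic G Gmatching.
Proof.
split; last first.
  move=> iso; case: Gmatching_core => H [B [[data isoB] miss common]].
  by exists H, B; split=> //; split=> //; apply: isomorphic_trans iso isoB.
case=> H [B [[data isoG]]]; rewrite addKn => -[f fbij fadj] [u uP].
apply: isomorphic_trans isoG _.
have [_ _ degB] := L2_data_core hk data.
have degf x : #|[set j | (x, j) \in B]| = if f x is inl _ then 1 else 0.
  by rewrite degB -(isomorphic_degree fbij fadj) matching_missing_degree.
apply: (@L2_isomorphic _ _ H matching_H B matching_B f (tperm u y0)) => //.
- exact: inv_bij (@tpermK _ u y0).
- move=> x x'; rewrite -[LHS]/((f x != f x') && ~~ adj (f x) (f x')) fadj.
  rewrite (inj_eq (bij_inj fbij)) -[RHS]adj_complement2.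
  by [].
- move=> x j; rewrite inE /=.
  have -> : (tperm u y0 j == y0) = (j == u) by rewrite -{2}(tpermL u y0) (inj_eq perm_inj).
  have := degf x; case fx: (f x) => [z|z].
    move=> /eqP/cards1P[j1 jE].
    have xu : (x, u) \in B.
      have : 0 < @degree (complement H) x.
        by rewrite -(isomorphic_degree fbij fadj) fx matching_missing_degree.
      rewrite card_gt0 => /set0Pn[x']; rewrite inE; exact: uP.
    have mem1 i : ((x, i) \in B) = (i == j1) by move/setP/(_ i): jE; rewrite !inE.
    by move: xu; rewrite !mem1 => /eqP ->.
  by move=> /eqP; rewrite cards_eq0 => /eqP/setP/(_ j); rewrite !inE /= => ->.
Qed.
End Instances.

(** The bounds behind [extremal_or_lt] depend on h and w = k - h - 1 only, and
    |W| + |Y| = n - 2h - 2, so one threshold serves the whole family. *)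
Lemma Gstar_unique_maximizer (R : realType) (k h : nat) :
  3 <= k -> 2 <= h <= k - 1 ->
  let delta := k + h in
  exists n_int : nat, 2 * delta + 2 <= n_int /\
    forall n : nat, n_int <= n ->
      [/\ exists2 Gm : sgraph,
            forall G : sgraph, matching_core n k delta G <-> isomorphic G Gm
            & ~ maximizes_rho n k delta R Gm,
          in_L2_with_missing n k delta (Gstar h k n) (star_missing h)
        & forall G : sgraph,
            maximizes_rho n k delta R G <-> isomorphic G (Gstar h k n)].
Proof.
move=> k3 /andP[h2 hk1] delta.
have hk : h < k by lia.
have h0 : 0 < h by lia.
pose w := sizeW k delta.
pose N0 := Num.bound (6 * moment_bound R h w + 1)%R.
exists (2 * delta + 2 + N0); split; first exact: leq_addr.
move=> n nN.
have nk : 2 * (k + h) + 2 <= n by apply: leq_trans nN; exact: leq_addr.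
pose y := Defs.sizeY n k delta.
have large : (6 * moment_bound R h w + 1 < (w + y)%:R)%R.
  have [E1 _] := moment_bound_ge R w h0.
  apply: lt_le_trans (archi_boundP _) _.
    by rewrite addr_ge0 // mulr_ge0 // (le_trans _ E1).
  rewrite ler_nat -/N0 /w /y /sizeW /Defs.sizeY /delta addKn.
  by move: nN; rewrite /delta; lia.
have sdata := star_core h2 hk nk; have sext := star_extremal h2 hk nk.
have dich := extremal_or_lt h0 sdata sext large.
have Lstar : in_L2 n k delta (Gstar h k n).
  by case: (Gstar_missing h2 hk nk) => H [B [LG _]]; exists H, B.
have isoG (H : sgraph) (B : {set H * 'I_y}) : L2_data B ->
    isomorphic (L2_graph w B) (Gstar h k n) \/
    (spectral_radius R (L2_graph w B) < spectral_radius R (Gstar h k n))%R.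
  move=> /(L2_data_core hk) data.
  have [[c [j0 ext]]|] := dich H B data; last by right.
  by left; apply: extremal_isomorphic data ext sdata sext.
have max_star : maximizes_rho n k delta R (Gstar h k n).
  split=> // G' [H [B [data /isomorphic_spectral_radius ->]]].
  have [/isomorphic_spectral_radius -> //|/ltW //] := isoG _ _ data.
split; first last.
- move=> G; split.
    case=> -[H [B [data iso]]] Gmax; have [isoS|lt] := isoG _ _ data.
      exact: isomorphic_trans iso isoS.
    by have := Gmax _ Lstar; rewrite (isomorphic_spectral_radius R iso) leNgt lt.
  move=> iso; split.
    case: Lstar => H [B [data isoB]]; exists H, B; split=> //.
    exact: isomorphic_trans iso isoB.
  by move=> G' G'L; rewrite (isomorphic_spectral_radius R iso); apply: (proj2 max_star).
- exact: Gstar_missing.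
exists (Gmatching h2 hk nk); first exact: matching_core_isomorphic.
case=> _ Mmax; have mdata := matching_core_data h2 hk nk.
have [[c [j0 [[degc _] _ _]]]|lt] := dich _ _ mdata.
  by move: degc; rewrite degree_complement2 matching_missing_degree; case: c => [] ?; lia.
by have := Mmax _ Lstar; rewrite leNgt lt.
Qed.

Theorem corollary1p2 (R : realType) :
  (forall k h : nat, 3 <= k -> 2 <= h <= k - 1 ->
    let delta := k + h in
    exists n_int : nat, 2 * delta + 2 <= n_int /\
      forall n : nat, n_int <= n ->
        [/\ exists2 Gm : sgraph,
              forall G : sgraph, matching_core n k delta G <-> isomorphic G Gm
              & ~ maximizes_rho n k delta R Gm,
            in_L2_with_missing n k delta (Gstar h k n) (star_missing h)
          & forall G : sgraph,
              maximizes_rho n k delta R G <-> isomorphic G (Gstar h k n)])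
  /\
  (forall k delta : nat, 3 <= k -> k + 2 <= delta <= 2 * k - 1 ->
    ~ matching_core_conjecture R k delta).
Proof.
split=> [k h|k delta k3 /andP[dk1 dk2] [N conj]].
  exact: Gstar_unique_maximizer.
pose h := delta - k; have deltaE : delta = k + h by rewrite /h; lia.
have hP : 2 <= h <= k - 1 by rewrite /h; lia.
have [n_int [_ int]] := Gstar_unique_maximizer R k3 hP.
have [[Gm coreP notmax] _ maxP] := int (maxn N n_int) (leq_maxr _ _).
have := conj (maxn N n_int) (leq_maxl _ _) (Gstar h k (maxn N n_int)).
rewrite deltaE => /(_ (proj2 (maxP _) (isomorphic_refl _))) /coreP isoS.
by apply: notmax; apply/maxP/isomorphic_sym.
Qed.
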